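(* Let $D\ge 1$ and let $H_0,H_1,\dots,H_M$ be Hermitian $D\times D$ complex matrices. Let $H(t)=\sum_{m=0}^M h_m(t)H_m$, where the $h_m:[0,\infty)\to\mathbb{R}$ are bounded and $H(t)$ is a piecewise continuous function of $t$. Let $U(t)$ be the unitary solution of $i\frac{d}{dt}U(t)=H(t)U(t)$, $U(0)=I$. Then for every $T\ge 0$ there exists a Hermitian matrix $C[T]$ such that $e^{-iC[T]}=U(T)$, $\; iC[T]\in\mathcal{L}(\{iH_m\})$, and $$\|C[T]\|_F\le\int_0^T\|H(t)\|_F\,dt .$$
   Context: $\|A\|_F=\sqrt{\operatorname{tr}A^\dagger A}$ is the Frobenius norm. $\mathcal{L}(\{iH_m\})$ denotes the dynamical Lie algebra: the smallest real vector space of $D\times D$ complex matrices containing $iH_0,\dots,iH_M$ and closed under real linear combinations and commutators $[X,Y]=XY-YX$. *)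

(* Defs.v *)
From HB Require Import structures.
From mathcomp Require Import all_boot all_order all_algebra.
From mathcomp Require Import all_classical all_reals all_analysis.
From mathcomp Require Import complex.
Set Implicit Arguments.
Unset Strict Implicit.
Unset Printing Implicit Defensive.
Import Order.TTheory GRing.Theory Num.Theory.
Import numFieldNormedType.Exports.
Local Open Scope ring_scope.
Local Open Scope classical_set_scope.
Local Open Scope complex_scope.

Section QuantumDefs.
Variable R : realType.
Local Notation C := R[i].

Definition mxadj n (A : 'M[C]_n) : 'M[C]_n := map_mx (@conjc R) A^T.

Definition is_hermitian n (A : 'M[C]_n) : Prop := mxadj A = A.

(* Frobenius norm ||A||_F = sqrt (tr A^dagger A); the trace is a nonnegative
   real number, so we take its real part before the real square root. *)
Definition frob n (A : 'M[C]_n) : R := Num.sqrt (complex.Re (\tr (mxadj A *m A))).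

Definition mx_lim {T : Type} n (F : set_system T) (f : T -> 'M[C]_n)
  (L : 'M[C]_n) : Prop :=
  (fun x => frob (f x - L)) @ F --> (0 : R).

Definition mxexp_is n (A B : 'M[C]_n.+1) : Prop :=
  mx_lim \oo (fun N : nat => \sum_(k < N) ((k`!)%:R)^-1 *: A ^+ k) B.

Definition mx_derivative n (f : R -> 'M[C]_n) (t : R) (V : 'M[C]_n) : Prop :=
  mx_lim (0 : R)^' (fun h : R => (h^-1)%:C *: (f (t + h) - f t)) V.

Definition pw_continuous n (f : R -> 'M[C]_n) : Prop :=
  forall T : R, 0 <= T -> exists s : seq R,
    [/\ forall t, 0 <= t <= T ->
          (0 < t -> exists L, mx_lim t^'- f L) /\ (exists L, mx_lim t^'+ f L),
        forall t, 0 < t <= T -> t \notin s -> mx_lim (nbhs t) f (f t)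
      & (0 : R) \notin s -> mx_lim (0 : R)^'+ f (f 0)].

Definition hamiltonian n M (Hm : 'I_M -> 'M[C]_n) (h : 'I_M -> R -> R)
  (t : R) : 'M[C]_n := \sum_(m < M) (h m t)%:C *: Hm m.

(* U solves i dU/dt = H(t) U, U(0) = I on [0, oo): U is continuous on [0, oo)
   and satisfies the equation at every t > 0 where H is continuous
   (i.e. everywhere except at the locally finitely many jumps of H). *)
Definition solves_schrodinger n (H U : R -> 'M[C]_n) : Prop :=
  [/\ U 0 = 1%:M,
      mx_lim (0 : R)^'+ U (U 0),
      forall t : R, 0 < t -> mx_lim (nbhs t) U (U t)
    & forall t : R, 0 < t -> mx_lim (nbhs t) H (H t) ->
        mx_derivative U t (- 'i%C *: (H t *m U t))].

Inductive dla n M (G : 'I_M -> 'M[C]_n) : 'M[C]_n -> Prop :=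
| dla_gen m : dla G (G m)
| dla_zero : dla G 0
| dla_add X Y : dla G X -> dla G Y -> dla G (X + Y)
| dla_scale (r : R) X : dla G X -> dla G (r%:C *: X)
| dla_comm X Y : dla G X -> dla G Y -> dla G (X *m Y - Y *m X).

End QuantumDefs.

(* Main.v *)
Require Import Defs.
From HB Require Import structures.
From mathcomp Require Import all_boot all_order all_algebra.
From mathcomp Require Import all_classical all_reals all_analysis.
From mathcomp Require Import complex.
From mathcomp Require Import ring lra measurable_realfun.
Import Order.TTheory GRing.Theory Num.Theory.
Import numFieldNormedType.Exports.
Local Open Scope ring_scope.
Local Open Scope classical_set_scope.
Local Open Scope complex_scope.

(** Complex [n x n] matrices are seen as real [2n x 2n] ones, so that the
    dynamical Lie algebra becomes a Lie algebra [L] of skew-symmetric matrices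
    and the Frobenius norm is multiplied by [sqrt 2].

    The key point is a discrete Hopf-Rinow theorem: for [X], [Y] in [L] there is
    [Z] in [L] with [e^Z = e^X e^Y] and [|Z| <= |X| + |Y|]. Write
    [g = e^X e^Y] as a product of many small exponentials and minimise the
    energy [sum_k |X_k|^2 / w_k + K (q - <P, g>)], [P = prod_k e^(X_k)], over
    all tuples of [L]. At a minimiser, the first-order conditions for rotating
    [X_k] and for moving it inside its centralizer force all [X_k / w_k] to be
    equal, so [P] is a single exponential of an element of [L], of norm at most
    [|X| + |Y|]; then let [K] tend to infinity. No logarithm or
    Baker-Campbell-Hausdorff series is needed.

    The propagator is then followed by continuous induction on time: for every
    [e > 0] and [t] there is [Z] in [L] with [|e^Z - U t| <= e t] and
    [|Z| <= e t + int_0^t |H|], and [e] tends to [0] by compactness. *)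

Set Implicit Arguments.
Unset Strict Implicit.
Unset Printing Implicit Defensive.

(** * Frobenius norm and convergence of real matrices *)

(** With [a], [b], [c] the three sums, the nonnegative sum of the squares of [c * f i - b * g i]
    equals [c * (a * c - b ^+ 2)]; divide by [c] when it is positive. *)
Lemma sum_cauchy_schwarz (R : realFieldType) (I : finType) (f g : I -> R) :
  (\sum_i f i * g i) ^+ 2 <= (\sum_i f i * f i) * (\sum_i g i * g i).
Proof.
set b := \sum_i f i * g i; set a := \sum_i f i * f i; set c := \sum_i g i * g i.
have c_ge0 : 0 <= c by apply: sumr_ge0 => i _; rewrite -expr2 sqr_ge0.
have [c0|c_neq0] := eqVneq c 0.
  have g0 i : g i = 0.
    apply/eqP; rewrite -sqrf_eq0 expr2; apply/eqP.
    by apply: (psumr_eq0P _ c0) => // j _; rewrite -expr2 sqr_ge0.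
  by rewrite c0 mulr0 /b big1 ?expr0n// => i _; rewrite g0 mulr0.
have c_gt0 : 0 < c by rewrite lt_def c_neq0.
have : 0 <= \sum_i (c * f i - b * g i) ^+ 2.
  by apply: sumr_ge0 => i _; exact: sqr_ge0.
have E x y : \sum_i (x * f i - y * g i) ^+ 2 =
    x ^+ 2 * a - 2 * x * y * b + y ^+ 2 * c.
  rewrite /a /b /c !mulr_sumr -sumrB -big_split/=.
  by apply: eq_bigr => i _; ring.
rewrite E (_ : _ + _ = c * (a * c - b ^+ 2)); last by ring.
by rewrite pmulr_rge0// subr_ge0.
Qed.

Section Frobenius.
Variable R : realType.

(** Rectangular shapes are allowed so that the same inner product serves for the row vectors
    [mxvec A]. *)
Definition dot m n (A B : 'M[R]_(m, n)) : R := \tr (A^T *m B).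

Definition fro m n (A : 'M[R]_(m, n)) : R := Num.sqrt (dot A A).

Lemma dotE m n (A B : 'M[R]_(m, n)) : dot A B = \sum_i \sum_j A i j * B i j.
Proof.
rewrite exchange_big; apply: eq_bigr => j _; rewrite mxE.
by apply: eq_bigr => i _; rewrite mxE.
Qed.

Lemma dotE_pair m n (A B : 'M[R]_(m, n)) :
  dot A B = \sum_(p : 'I_m * 'I_n) A p.1 p.2 * B p.1 p.2.
Proof. by rewrite dotE pair_big. Qed.

Lemma dotC m n (A B : 'M[R]_(m, n)) : dot A B = dot B A.
Proof. by rewrite /dot -mxtrace_tr trmx_mul trmxK. Qed.

Lemma dotDr m n (A B C : 'M[R]_(m, n)) : dot A (B + C) = dot A B + dot A C.
Proof. by rewrite /dot mulmxDr raddfD. Qed.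

Lemma dotZr m n r (A B : 'M[R]_(m, n)) : dot A (r *: B) = r * dot A B.
Proof. by rewrite /dot -scalemxAr linearZ. Qed.

Lemma dotNr m n (A B : 'M[R]_(m, n)) : dot A (- B) = - dot A B.
Proof. by rewrite /dot mulmxN raddfN. Qed.

Lemma dotBr m n (A B C : 'M[R]_(m, n)) : dot A (B - C) = dot A B - dot A C.
Proof. by rewrite dotDr dotNr. Qed.

Lemma dotDl m n (A B C : 'M[R]_(m, n)) : dot (B + C) A = dot B A + dot C A.
Proof. by rewrite !(dotC _ A) dotDr. Qed.

Lemma dotZl m n r (A B : 'M[R]_(m, n)) : dot (r *: B) A = r * dot B A.
Proof. by rewrite !(dotC _ A) dotZr. Qed.

Lemma dotBl m n (A B C : 'M[R]_(m, n)) : dot (B - C) A = dot B A - dot C A.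
Proof. by rewrite !(dotC _ A) dotBr. Qed.

Lemma dotMl m n p (A : 'M[R]_(m, n)) (B : 'M[R]_(n, p)) C :
  dot (A *m B) C = dot B (A^T *m C).
Proof. by rewrite /dot trmx_mul mulmxA. Qed.

Lemma dotMr m n p (A : 'M[R]_(m, n)) (B : 'M[R]_(n, p)) C :
  dot (A *m B) C = dot A (C *m B^T).
Proof. by rewrite /dot trmx_mul mxtrace_mulC !mulmxA mxtrace_mulC mulmxA. Qed.

Lemma dot_ge0 m n (A : 'M[R]_(m, n)) : 0 <= dot A A.
Proof.
by rewrite dotE_pair; apply: sumr_ge0 => p _; rewrite -expr2 sqr_ge0.
Qed.

Lemma dot_eq0 m n (A : 'M[R]_(m, n)) : dot A A = 0 -> A = 0.
Proof.
rewrite dotE_pair => /psumr_eq0P A0; apply/matrixP => i j; rewrite mxE.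
apply/eqP; rewrite -sqrf_eq0 expr2; apply/eqP.
by apply: (A0 _ (i, j)) => // p _; rewrite -expr2 sqr_ge0.
Qed.

Lemma fro_ge0 m n (A : 'M[R]_(m, n)) : 0 <= fro A.
Proof. exact: sqrtr_ge0. Qed.
Hint Resolve fro_ge0 : core.

Lemma sqr_fro m n (A : 'M[R]_(m, n)) : fro A ^+ 2 = dot A A.
Proof. by rewrite sqr_sqrtr ?dot_ge0. Qed.

Lemma fro_eq0 m n (A : 'M[R]_(m, n)) : fro A = 0 -> A = 0.
Proof. by move=> A0; apply: dot_eq0; rewrite -sqr_fro A0 expr0n. Qed.

Lemma fro_gt0 m n (A : 'M[R]_(m, n)) : A != 0 -> 0 < fro A.
Proof.
by move=> A0; rewrite lt_def fro_ge0 andbT; apply: contra_neq A0 => /fro_eq0.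
Qed.

Lemma froZ m n r (A : 'M[R]_(m, n)) : fro (r *: A) = `|r| * fro A.
Proof. by rewrite /fro dotZl dotZr mulrA -expr2 sqrtrM ?sqr_ge0// sqrtr_sqr. Qed.

Lemma fro0 m n : fro (0 : 'M[R]_(m, n)) = 0.
Proof. by rewrite -(scale0r 0) froZ normr0 mul0r. Qed.

Lemma froN m n (A : 'M[R]_(m, n)) : fro (- A) = fro A.
Proof. by rewrite -scaleN1r froZ normrN normr1 mul1r. Qed.

Lemma froBC m n (A B : 'M[R]_(m, n)) : fro (A - B) = fro (B - A).
Proof. by rewrite -froN opprB. Qed.

Lemma dot_le m n (A B : 'M[R]_(m, n)) : `|dot A B| <= fro A * fro B.
Proof.
rewrite -(@ler_pXn2r _ 2) ?nnegrE ?mulr_ge0//.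
rewrite exprMn !sqr_fro real_normK ?num_real// !dotE_pair.
exact: sum_cauchy_schwarz.
Qed.

Lemma froD m n (A B : 'M[R]_(m, n)) : fro (A + B) <= fro A + fro B.
Proof.
rewrite -(@ler_pXn2r _ 2) ?nnegrE ?addr_ge0//.
rewrite sqrrD !sqr_fro dotDl !dotDr (dotC B A).
have := le_trans (ler_norm _) (dot_le A B); lra.
Qed.

Lemma froB m n (A B : 'M[R]_(m, n)) : fro (A - B) <= fro A + fro B.
Proof. by rewrite -(froN B) froD. Qed.

Lemma fro_dist m n (A B C : 'M[R]_(m, n)) :
  fro (A - C) <= fro (A - B) + fro (B - C).
Proof. by apply: le_trans (froD _ _); rewrite addrA subrK. Qed.

Lemma fro_leB m n (A B : 'M[R]_(m, n)) : fro A <= fro B + fro (A - B).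
Proof. by apply: le_trans (froD _ _); rewrite addrC subrK. Qed.

Lemma fro_sum m n (I : Type) (r : seq I) (P : pred I) (f : I -> 'M[R]_(m, n)) :
  fro (\sum_(i <- r | P i) f i) <= \sum_(i <- r | P i) fro (f i).
Proof.
apply: (big_ind2 (fun A x => fro A <= x)); rewrite ?fro0// => A x B y Ax By.
exact: le_trans (froD _ _) (lerD Ax By).
Qed.

Lemma froM m n p (A : 'M[R]_(m, n)) (B : 'M[R]_(n, p)) :
  fro (A *m B) <= fro A * fro B.
Proof.
rewrite -(@ler_pXn2r _ 2) ?nnegrE ?mulr_ge0//.
rewrite exprMn !sqr_fro !dotE [X in _ <= _ * X]exchange_big/= mulr_suml.
apply: ler_sum => i _; rewrite mulr_sumr; apply: ler_sum => j _.
by rewrite mxE -expr2 sum_cauchy_schwarz.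
Qed.

Lemma norm_entry_le_fro m n (A : 'M[R]_(m, n)) i j : `|A i j| <= fro A.
Proof.
rewrite -sqrtr_sqr /fro ler_wsqrtr// dotE_pair (bigD1 (i, j))//= -expr2.
by rewrite lerDl; apply: sumr_ge0 => p _; rewrite -expr2 sqr_ge0.
Qed.

(** Carrying a factor [A] along keeps the induction free of [fro 1%:M], which is the square root of
    [q] and not 1. *)
Lemma froMn_pow q (X : 'M[R]_q) (A : 'M[R]_q) k :
  fro (X ^+ k *m A) <= fro X ^+ k * fro A.
Proof.
elim: k => [|k ih]; first by rewrite !expr0 mul1mx mul1r.
rewrite !exprS -mulmxE -mulmxA -mulrA.
by apply: le_trans (froM _ _) _; rewrite ler_wpM2l.
Qed.

Lemma fro_pow q (X : 'M[R]_q) k :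
  fro (X ^+ k) <= fro X ^+ k * fro (1%:M : 'M[R]_q).
Proof. by rewrite -{1}(mulmx1 (X ^+ k)) froMn_pow. Qed.

Lemma fro_powS q (X : 'M[R]_q) k : fro (X ^+ k.+1) <= fro X ^+ k.+1.
Proof. by rewrite !exprSr -mulmxE froMn_pow. Qed.

Lemma fro_orthoMl q (Q A : 'M[R]_q) : Q^T *m Q = 1%:M -> fro (Q *m A) = fro A.
Proof. by move=> QQ; rewrite /fro dotMl mulmxA QQ mul1mx. Qed.

Lemma fro_orthoMr q (Q A : 'M[R]_q) : Q *m Q^T = 1%:M -> fro (A *m Q) = fro A.
Proof. by move=> QQ; rewrite /fro dotMr -mulmxA QQ mulmx1. Qed.

End Frobenius.
#[global] Hint Extern 0 (is_true (0 <= fro _)) => apply: fro_ge0 : core.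

(** * Convergence of matrices along a filter *)

Section MatrixConvergence.
Variable R : realType.

(** Taken entrywise, so that limits of sums and products reduce to scalar ones; [mxcvgP] identifies
    it with convergence in the Frobenius norm. *)
Definition mxcvg T (F : set_system T) m n (f : T -> 'M[R]_(m, n)) (l : 'M[R]_(m, n)) :=
  forall i j, f x i j @[x --> F] --> l i j.

Lemma cvg_sumr T (F : set_system T) (FF : Filter F) (I : Type) (r : seq I)
    (f : I -> T -> R) (l : I -> R) :
  (forall i, f i x @[x --> F] --> l i) ->
  \sum_(i <- r) f i x @[x --> F] --> \sum_(i <- r) l i.
Proof. by move=> fl; apply: cvg_big => // -[x y]; exact: add_continuous. Qed.

Context T (F : set_system T) {FF : Filter F}.

Lemma mxcvg_cst m n (A : 'M[R]_(m, n)) : mxcvg F (fun=> A) A.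
Proof. by move=> i j; exact: cvg_cst. Qed.

Lemma mxcvgD m n (f g : T -> 'M[R]_(m, n)) a b :
  mxcvg F f a -> mxcvg F g b -> mxcvg F (fun x => f x + g x) (a + b).
Proof.
move=> fa gb i j; rewrite mxE.
by under eq_cvg do rewrite mxE; apply: cvgD.
Qed.

Lemma mxcvgZ m n (c : T -> R) (f : T -> 'M[R]_(m, n)) (r : R) a :
  c x @[x --> F] --> r -> mxcvg F f a -> mxcvg F (fun x => c x *: f x) (r *: a).
Proof.
move=> cr fa i j; rewrite mxE.
by under eq_cvg do rewrite mxE; apply: cvgM.
Qed.

Lemma mxcvgN m n (f : T -> 'M[R]_(m, n)) a :
  mxcvg F f a -> mxcvg F (fun x => - f x) (- a).
Proof.
move=> fa i j; rewrite mxE.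
by under eq_cvg do rewrite mxE; apply: cvgN.
Qed.

Lemma mxcvgB m n (f g : T -> 'M[R]_(m, n)) a b :
  mxcvg F f a -> mxcvg F g b -> mxcvg F (fun x => f x - g x) (a - b).
Proof. by move=> fa gb; apply: mxcvgD => //; exact: mxcvgN. Qed.

Lemma mxcvgM m n p (f : T -> 'M[R]_(m, n)) (g : T -> 'M[R]_(n, p)) a b :
  mxcvg F f a -> mxcvg F g b -> mxcvg F (fun x => f x *m g x) (a *m b).
Proof.
move=> fa gb i j; rewrite mxE; under eq_cvg do rewrite mxE.
by apply: cvg_sumr => k; apply: cvgM.
Qed.

Lemma mxcvg_tr m n (f : T -> 'M[R]_(m, n)) a :
  mxcvg F f a -> mxcvg F (fun x => (f x)^T) a^T.
Proof.
by move=> fa i j; rewrite mxE; under eq_cvg do rewrite mxE; exact: fa.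
Qed.

Lemma cvg_dot m n (f g : T -> 'M[R]_(m, n)) a b :
  mxcvg F f a -> mxcvg F g b -> dot (f x) (g x) @[x --> F] --> dot a b.
Proof.
move=> fa gb; rewrite dotE; under eq_cvg do rewrite dotE.
apply: cvg_sumr => i; apply: (cvg_sumr _ (f := fun j x => f x i j * g x i j)) => j.
exact: cvgM (fa i j) (gb i j).
Qed.

Lemma cvg_fro m n (f : T -> 'M[R]_(m, n)) a :
  mxcvg F f a -> fro (f x) @[x --> F] --> fro a.
Proof.
move=> fa; apply: (@continuous_cvg _ _ _ F FF _ Num.sqrt).
  exact: sqrt_continuous.
exact: cvg_dot.
Qed.

Lemma mxcvgP m n (f : T -> 'M[R]_(m, n)) a :
  mxcvg F f a <-> fro (f x - a) @[x --> F] --> (0 : R).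
Proof.
split=> [fa|fa i j].
  rewrite -(fro0 R m n) -(subrr a); apply: cvg_fro.
  by apply: mxcvgB => //; exact: mxcvg_cst.
apply/subr_cvg0; apply/norm_cvg0P.
apply: (@squeeze_cvgr _ _ _ _ (cst 0) (fun x => fro (f x - a))) => //; last first.
  exact: cvg_cst.
near=> x; rewrite /= normr_ge0/=; apply: le_trans (norm_entry_le_fro _ i j).
by rewrite !mxE.
Unshelve. all: by end_near. Qed.

Lemma mxcvg_le m n (f : T -> 'M[R]_(m, n)) a (e : T -> R) :
  (\forall x \near F, fro (f x - a) <= e x) -> e x @[x --> F] --> (0 : R) ->
  mxcvg F f a.
Proof.
move=> fe e0; apply/mxcvgP.
apply: (@squeeze_cvgr _ _ _ _ (cst 0) e) => //; last exact: cvg_cst.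
by near=> x; rewrite /= fro_ge0/=; near: x.
Unshelve. all: by end_near. Qed.

End MatrixConvergence.

Lemma mxcvg_unique (R : realType) T (F : set_system T) {FF : ProperFilter F} m n
    (f : T -> 'M[R]_(m, n)) a b : mxcvg F f a -> mxcvg F f b -> a = b.
Proof.
move=> fa fb; apply/matrixP => i j.
exact: (cvg_unique (@norm_hausdorff _ _) (fa i j) (fb i j)).
Qed.

(** * The matrix exponential *)

Lemma sum_triangle (V : nmodType) (f : nat -> nat -> V) N :
  \sum_(k < N) \sum_(i < k.+1) f i (k - i)%N = \sum_(i < N) \sum_(j < N - i) f i j.
Proof.
elim: N => [|N ih]; first by rewrite !big_ord0.
rewrite big_ord_recr/= ih.
have -> : \sum_(i < N) \sum_(j < N - i) f i j =
          \sum_(i < N.+1) \sum_(j < N - i) f i j.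
  by rewrite [RHS]big_ord_recr/= subnn big_ord0 addr0.
rewrite -big_split/=; apply: eq_bigr => i _.
have iN : (i <= N)%N by rewrite -ltnS.
by rewrite (subSn iN) big_ord_recr.
Qed.

(** The Cauchy product of two truncated series: the square of indices splits into the antidiagonals
    [i + j < N] and a corner [N <= i + j]. *)
Lemma sum_square (V : nmodType) (f : nat -> nat -> V) N :
  \sum_(i < N) \sum_(j < N) f i j =
  \sum_(k < N) \sum_(i < k.+1) f i (k - i)%N +
  \sum_(i < N) \sum_(N - i <= j < N) f i j.
Proof.
rewrite sum_triangle -big_split/=; apply: eq_bigr => i _.
by rewrite -!(big_mkord xpredT) -big_cat_nat// leq_subr.
Qed.

Section ScalarSeries.
Variable R : realType.
Implicit Types x y : R.

Definition expsum x N := \sum_(k < N) x ^+ k / k`!%:R.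

Lemma expsum_series x : expsum x = series (exp_coeff x).
Proof. by apply/funext => N; rewrite seriesEord. Qed.

Lemma cvg_expsum x : expsum x N @[N --> \oo] --> expR x.
Proof. by rewrite expsum_series; exact: is_cvg_series_exp_coeff. Qed.

Lemma expsum_le x N : 0 <= x -> expsum x N <= expR x.
Proof.
move=> x0; rewrite expsum_series; apply: nondecreasing_cvgn_le.
  by apply: nondecreasing_series => n _ _; exact: exp_coeff_ge0.
exact: is_cvg_series_exp_coeff.
Qed.

Lemma exp_conv x y k :
  \sum_(i < k.+1) (x ^+ i / i`!%:R) * (y ^+ (k - i) / (k - i)`!%:R) =
  (x + y) ^+ k / k`!%:R.
Proof.
rewrite addrC exprDn mulr_suml; apply: eq_bigr => i _.
have fact_neq0 j : (j`!%:R : R) != 0 by rewrite pnatr_eq0 -lt0n fact_gt0.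
have /(congr1 (fun n => n%:R : R)) : ('C(k, i) * (i`! * (k - i)`!))%N = k`!.
  by apply: bin_fact; rewrite -ltnS.
rewrite -mulr_natr !natrM => <-.
have C_neq0 : ('C(k, i)%:R : R) != 0.
  by rewrite pnatr_eq0 -lt0n bin_gt0 -ltnS.
by field; rewrite !fact_neq0 C_neq0.
Qed.

(** By the Cauchy product the corner equals [expsum x N * expsum y N - expsum (x + y) N], and both
    terms tend to [expR (x + y)]. It dominates the corner of the matrix series in [cvg_expconv]. *)
Lemma cvg_exp_corner x y :
  \sum_(i < N) \sum_(N - i <= j < N) (x ^+ i / i`!%:R) * (y ^+ j / j`!%:R)
    @[N --> \oo] --> (0 : R).
Proof.
rewrite [X in X @ _ --> _](_ : _ =
    (fun N => expsum x N * expsum y N - expsum (x + y) N)); last first.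
  apply/funext => N; apply/eqP; rewrite eq_sym subr_eq eq_sym addrC; apply/eqP.
  rewrite /expsum big_distrl/=.
  under [RHS]eq_bigr do rewrite big_distrr/=.
  rewrite (sum_square (fun i j => x ^+ i / i`!%:R * (y ^+ j / j`!%:R))).
  by congr +%R; apply: eq_bigr => k _; rewrite exp_conv.
rewrite -(subrr (expR (x + y))) {1}expRD.
by apply: cvgB; [apply: cvgM|]; exact: cvg_expsum.
Qed.

End ScalarSeries.

Section MatrixExponential.
Variables (R : realType) (q : nat).
Implicit Types A X Y : 'M[R]_q.

Definition expser X N : 'M[R]_q := \sum_(k < N) (k`!%:R)^-1 *: X ^+ k.

Definition expm X : 'M[R]_q := \matrix_(i, j) limn (fun N => expser X N i j).

Lemma fact_inv_ge0 k : 0 <= (k`!%:R)^-1 :> R.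
Proof. by rewrite invr_ge0 ler0n. Qed.
Hint Resolve fact_inv_ge0 : core.

(** Each entry is a series dominated by [fro 1%:M] times the exponential series of [fro X]. *)
Lemma cvg_expser X : mxcvg \oo (expser X) (expm X).
Proof.
move=> i j; rewrite mxE.
pose u k := (k`!%:R)^-1 * (X ^+ k) i j.
have -> : (fun N => expser X N i j) = series u.
  by apply/funext => N; rewrite seriesEord summxE; apply: eq_bigr => k _; rewrite mxE.
apply: normed_cvg.
apply: (@series_le_cvg _ _ (fro (1%:M : 'M[R]_q) *: exp_coeff (fro X))).
- by move=> k /=.
- by move=> k /=; rewrite mulr_ge0//; apply: exp_coeff_ge0.
- move=> k /=; rewrite normrM ger0_norm// /exp_coeff/=.
  apply: le_trans (ler_wpM2l _ (norm_entry_le_fro _ i j)) _ => //.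
  apply: le_trans (ler_wpM2l _ (fro_pow _ _)) _ => //.
  change (k`!%:R^-1 * (fro X ^+ k * fro (1%:M : 'M[R]_q)) <=
    fro (1%:M : 'M[R]_q) * (fro X ^+ k / k`!%:R)).
  by rewrite mulrC -mulrA mulrCA.
- by apply: is_cvg_seriesZ; exact: is_cvg_series_exp_coeff.
Qed.
Arguments cvg_expser X : clear implicits.

(** The part of total degree [k] in [X] and [Y] of the product of [e^X], [A] and [e^Y]. For
    [Y = - X] it is the [k]-th iterated bracket of [X] with [A], divided by [k!]. *)
Definition expconv X A Y k : 'M[R]_q :=
  \sum_(i < k.+1) ((i`!%:R)^-1 * ((k - i)`!%:R)^-1) *: (X ^+ i *m A *m Y ^+ (k - i)).

Lemma factS_inv k : (k.+1)%:R * ((k.+1)`!%:R)^-1 = (k`!%:R)^-1 :> R.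
Proof.
by rewrite factS natrM invfM mulrA divff ?mul1r// pnatr_eq0.
Qed.

Lemma expconv0 X A Y : expconv X A Y 0 = A.
Proof.
by rewrite /expconv big_ord_recl big_ord0 addr0 subn0 !expr0 fact0 invr1 mul1r
  scale1r mul1mx mulmx1.
Qed.

(** This recursion replaces binomial sums: it yields the addition law [expmD] and, for [Y = - X],
    exhibits each term as a bracket, which is what [lie_Ad] uses. *)
Lemma expconvS X A Y k :
  (k.+1)%:R *: expconv X A Y k.+1 = X *m expconv X A Y k + expconv X A Y k *m Y.
Proof.
pose t i j := ((i`!%:R)^-1 * (j`!%:R)^-1 : R) *: (X ^+ i *m A *m Y ^+ j).
have tl i j : X *m t i j = i.+1%:R *: t i.+1 j.
  rewrite /t scalerA mulrA factS_inv -scalemxAr !mulmxA; congr (_ *: (_ *m _ *m _)).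
  by rewrite exprS.
have tr i j : t i j *m Y = j.+1%:R *: t i j.+1.
  rewrite /t scalerA mulrCA factS_inv -scalemxAl -!mulmxA.
  by congr (_ *: (_ *m (_ *m _))); rewrite exprSr.
have -> : X *m expconv X A Y k = \sum_(i < k.+2) i%:R *: t i (k.+1 - i)%N.
  rewrite big_ord_recl/= scale0r add0r /expconv mulmx_sumr.
  by apply: eq_bigr => i _; rewrite -/(t i (k - i)%N) tl subSS.
have -> : expconv X A Y k *m Y = \sum_(i < k.+2) (k.+1 - i)%:R *: t i (k.+1 - i)%N.
  rewrite big_ord_recr/= subnn scale0r addr0 /expconv mulmx_suml.
  by apply: eq_bigr => i _; rewrite -/(t i (k - i)%N) tr subSn// -ltnS.
rewrite -big_split/= scaler_sumr; apply: eq_bigr => i _.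
by rewrite -/(t i (k.+1 - i)%N) -scalerDl -natrD subnKC// -ltnS.
Qed.

(** The sum over [k < N] is the product of the truncated series minus a corner, whose norm is at
    most a constant times the scalar corner of [cvg_exp_corner]. *)
Lemma cvg_expconv X A Y :
  mxcvg \oo (fun N => \sum_(k < N) expconv X A Y k) (expm X *m A *m expm Y).
Proof.
pose t i j := ((i`!%:R)^-1 * (j`!%:R)^-1 : R) *: (X ^+ i *m A *m Y ^+ j).
pose corner N := \sum_(i < N) \sum_(N - i <= j < N) t i j.
have E N : \sum_(k < N) expconv X A Y k =
    expser X N *m A *m expser Y N - corner N.
  apply/eqP; rewrite eq_sym subr_eq; apply/eqP.
  rewrite /expser !mulmx_suml -(sum_square t); apply: eq_bigr => i _.
  rewrite mulmx_sumr; apply: eq_bigr => j _.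
  by rewrite -!scalemxAl -scalemxAr scalerA.
have corner0 : mxcvg \oo corner 0.
  pose c := fro A * fro (1%:M : 'M[R]_q).
  pose e N := c * \sum_(i < N) \sum_(N - i <= j < N)
    (fro X ^+ i / i`!%:R) * (fro Y ^+ j / j`!%:R).
  apply: (@mxcvg_le _ _ _ _ _ _ _ _ e); last first.
    by rewrite -(mulr0 c); apply: cvgM; [exact: cvg_cst|exact: cvg_exp_corner].
  apply: nearW => N; rewrite subr0 /e mulr_sumr.
  apply: le_trans (fro_sum _ _ _) _; apply: ler_sum => i _.
  rewrite mulr_sumr; apply: le_trans (fro_sum _ _ _) _; apply: ler_sum => j _.
  rewrite /t froZ ger0_norm ?mulr_ge0// -mulmxA.
  have : fro (X ^+ i *m (A *m Y ^+ j)) <=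
      fro X ^+ i * (fro A * (fro Y ^+ j * fro (1%:M : 'M[R]_q))).
    apply: le_trans (froMn_pow _ _ _) _; rewrite ler_wpM2l ?exprn_ge0//.
    by apply: le_trans (froM _ _) _; rewrite ler_wpM2l// fro_pow.
  move=> /(ler_wpM2l (mulr_ge0 (fact_inv_ge0 i) (fact_inv_ge0 j))) /le_trans; apply.
  rewrite le_eqVlt; apply/orP; left; apply/eqP; rewrite /c.
  by move: (fro X ^+ i) (fro Y ^+ j) (_^-1) (_^-1) => *; ring.
have -> : (fun N => \sum_(k < N) expconv X A Y k) =
    (fun N => expser X N *m A *m expser Y N - corner N) by apply/funext.
rewrite -[X in mxcvg _ _ X]subr0; apply: mxcvgB => //.
apply: mxcvgM; last exact: cvg_expser.
by apply: mxcvgM; [exact: cvg_expser|exact: mxcvg_cst].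
Qed.
Arguments cvg_expconv X A Y : clear implicits.

(** For commuting [X] and [Y], the terms [expconv X 1%:M Y k] and [(X + Y) ^+ k / k!] satisfy the
    same recursion. *)
Lemma expmD X Y : X *m Y = Y *m X -> expm (X + Y) = expm X *m expm Y.
Proof.
move=> XY; apply: mxcvg_unique (cvg_expser (X + Y)) _.
have E k : expconv X 1%:M Y k = (k`!%:R)^-1 *: (X + Y) ^+ k.
  elim: k => [|k ih]; first by rewrite expconv0 fact0 invr1 scale1r expr0.
  have k_neq0 : (k.+1)%:R != 0 :> R by rewrite pnatr_eq0.
  apply: (scalerI k_neq0); rewrite expconvS scalerA factS_inv ih.
  rewrite -scalemxAl -scalemxAr -scalerDr exprS -[_ * (_ ^+ _)]/(_ *m _) mulmxDl.
  congr (_ *: (_ + _)).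
  have YC : GRing.comm Y (X + Y) by rewrite /GRing.comm mulrDl mulrDr -!mulmxE XY.
  by have := commrX k YC; rewrite /GRing.comm -!mulmxE => <-.
have := cvg_expconv X 1%:M Y; rewrite mulmx1.
by congr mxcvg; apply/funext => N; apply: eq_bigr.
Qed.

Lemma expm0 : expm 0 = 1%:M.
Proof.
(* The empty partial sum is 0, so the sequence is constantly 1 only from index 1 on. *)
apply: mxcvg_unique (cvg_expser 0) _ => i j; rewrite -(cvg_shiftn 1).
have E N : expser 0 (N + 1) = 1%:M.
  rewrite addn1 /expser big_ord_recl/= fact0 invr1 scale1r expr0 big1 ?addr0// => k _.
  by rewrite exprS mul0r scaler0.
by under eq_cvg do rewrite /= E; exact: cvg_cst.
Qed.

Lemma expmNK X : expm (- X) *m expm X = 1%:M.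
Proof. by rewrite -expmD ?addNr ?expm0// mulNmx mulmxN. Qed.

Lemma trmxX X k : (X ^+ k)^T = X^T ^+ k.
Proof.
elim: k => [|k ih]; first by rewrite !expr0 trmx1.
by rewrite exprS exprSr -ih -!mulmxE trmx_mul.
Qed.

Lemma expm_tr X : expm X^T = (expm X)^T.
Proof.
apply: mxcvg_unique (cvg_expser X^T) _.
have -> : expser X^T = fun N => (expser X N)^T.
  apply/funext => N; rewrite /expser raddf_sum/=; apply: eq_bigr => k _.
  by rewrite linearZ/= trmxX.
by apply: mxcvg_tr; exact: cvg_expser.
Qed.

Lemma expm_conj A B X : B *m A = 1%:M -> expm (A *m X *m B) = A *m expm X *m B.
Proof.
move=> BA; have AB := mulmx1C BA.
apply: mxcvg_unique (cvg_expser (A *m X *m B)) _.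
have E k : (A *m X *m B) ^+ k = A *m X ^+ k *m B.
  elim: k => [|k ih]; first by rewrite !expr0 mulmx1 AB.
  by rewrite exprS ih exprS -!mulmxE !mulmxA -(mulmxA _ B A) BA mulmx1.
have -> : expser (A *m X *m B) = fun N => A *m expser X N *m B.
  apply/funext => N; rewrite /expser mulmx_sumr mulmx_suml; apply: eq_bigr => k _.
  by rewrite E -scalemxAr -scalemxAl.
apply: mxcvgM; last exact: mxcvg_cst.
by apply: mxcvgM; [exact: mxcvg_cst|exact: cvg_expser].
Qed.

Lemma fro_lim_le T (F : set_system T) (FF : ProperFilter F) m n
    (f : T -> 'M[R]_(m, n)) a (b : R) :
  mxcvg F f a -> (\forall x \near F, fro (f x) <= b) -> fro a <= b.
Proof. by move=> /cvg_fro fa; exact: cvgr_to_le. Qed.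

Definition exptail X N : 'M[R]_q := \sum_(k < N) (k.+2`!%:R)^-1 *: X ^+ k.+2.

Lemma cvg_exptail X : mxcvg \oo (exptail X) (expm X - 1%:M - X).
Proof.
have -> : exptail X = fun N => expser X (N + 2) - 1%:M - X.
  apply/funext => N; rewrite addn2 /expser !big_ord_recl/= fact0 invr1 scale1r.
  have cancel2 (a b c : 'M[R]_q) : c = a + (b + c) - a - b.
    by rewrite [a + _]addrC addrK [b + c]addrC addrK.
  rewrite scale1r expr0 expr1; exact: cancel2.
apply: mxcvgB; last exact: mxcvg_cst.
apply: mxcvgB; last exact: mxcvg_cst.
move=> i j; have := @cvg_expser X i j.
by rewrite -(cvg_shiftn 2).
Qed.
Arguments cvg_exptail X : clear implicits.

(** Factor out [fro X ^+ 2] and use [k! <= (k+2)!] to compare the rest with the series of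
    [expR (fro X)]. *)
Lemma fro_exptail X : fro (expm X - 1%:M - X) <= fro X ^+ 2 * expR (fro X).
Proof.
apply: (fro_lim_le _ (cvg_exptail X)); apply: nearW => N.
apply: le_trans (fro_sum _ _ _) _.
apply: (@le_trans _ _ (fro X ^+ 2 * expsum (fro X) N)); last first.
  by rewrite ler_wpM2l ?sqr_ge0// expsum_le.
rewrite /expsum mulr_sumr; apply: ler_sum => k _.
rewrite froZ ger0_norm// mulrA -exprD add2n mulrC.
apply: ler_pM => //; first exact: fro_powS.
rewrite lef_pV2 ?posrE ?ltr0n ?fact_gt0// ler_nat.
by rewrite !factS mulnA leq_pmull.
Qed.

(** Induction by moving one factor at a time across [A]. Two matrices [X], [Y] are kept so that one
    estimate covers both commutators ([X = Y]) and differences of powers ([A = 1%:M]). *)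
Lemma fro_comm_pow A X Y r k : fro X <= r -> fro Y <= r ->
  fro (A *m X ^+ k.+1 - Y ^+ k.+1 *m A) <= k.+1%:R * r ^+ k * fro (A *m X - Y *m A).
Proof.
move=> Xr Yr; have r0 : 0 <= r := le_trans (fro_ge0 _) Xr.
elim: k => [|k ih]; first by rewrite !expr1 expr0 !mul1r.
have -> : A *m X ^+ k.+2 - Y ^+ k.+2 *m A =
    (A *m X ^+ k.+1 - Y ^+ k.+1 *m A) *m X + Y ^+ k.+1 *m (A *m X - Y *m A).
  rewrite !(exprSr _ k.+1) -!mulmxE mulmxBl mulmxBr !mulmxA.
  by rewrite addrA subrK.
apply: le_trans (froD _ _) _.
have h1 : fro ((A *m X ^+ k.+1 - Y ^+ k.+1 *m A) *m X) <=
    k.+1%:R * r ^+ k.+1 * fro (A *m X - Y *m A).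
  apply: le_trans (froM _ _) _.
  by rewrite [r ^+ k.+1]exprSr mulrA (mulrAC _ r); apply: ler_pM.
have h2 : fro (Y ^+ k.+1 *m (A *m X - Y *m A)) <= r ^+ k.+1 * fro (A *m X - Y *m A).
  apply: le_trans (froMn_pow _ _ _) _; rewrite ler_wpM2r//.
  by rewrite ler_pXn2r ?nnegrE.
apply: le_trans (lerD h1 h2) _.
by rewrite -mulrDl -{2}[r ^+ k.+1]mul1r -mulrDl natr1.
Qed.

(** The term of degree [k + 2] contributes at most [(k+2) r^(k+1) / (k+2)! = r^(k+1) / (k+1)!], and
    these sum to at most [expR r - 1]. *)
Lemma fro_comm_exptail A X Y r : fro X <= r -> fro Y <= r ->
  fro (A *m (expm X - 1%:M - X) - (expm Y - 1%:M - Y) *m A) <=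
  (expR r - 1) * fro (A *m X - Y *m A).
Proof.
move=> Xr Yr; have r0 : 0 <= r := le_trans (fro_ge0 _) Xr.
have cvg : mxcvg \oo (fun N => A *m exptail X N - exptail Y N *m A)
    (A *m (expm X - 1%:M - X) - (expm Y - 1%:M - Y) *m A).
  by apply: mxcvgB; apply: mxcvgM; (exact: cvg_exptail || exact: mxcvg_cst).
apply: (fro_lim_le _ cvg); apply: nearW => N.
rewrite /exptail mulmx_sumr mulmx_suml -sumrB.
apply: le_trans (fro_sum _ _ _) _.
apply: (@le_trans _ _ ((expsum r N.+1 - 1) * fro (A *m X - Y *m A))); last first.
  by rewrite ler_wpM2r// lerB// expsum_le.
rewrite /expsum big_ord_recl expr0 fact0 divr1 addrAC subrr add0r mulr_suml.
apply: ler_sum => k _ /=.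
rewrite -scalemxAl -scalemxAr -scalerBr froZ ger0_norm//.
apply: le_trans (ler_wpM2l _ (fro_comm_pow _ _ Xr Yr)) _ => //.
rewrite !mulrA [_^-1 * _]mulrC factS_inv -[bump 0 k]/k.+1.
by rewrite [_^-1 * _]mulrC.
Qed.

Lemma fro_comm_expm A X Y r : fro X <= r -> fro Y <= r ->
  fro (A *m expm X - expm Y *m A) <= expR r * fro (A *m X - Y *m A).
Proof.
move=> Xr Yr.
have -> : A *m expm X - expm Y *m A =
    (A *m (expm X - 1%:M - X) - (expm Y - 1%:M - Y) *m A) + (A *m X - Y *m A).
  rewrite !mulmxBr !mulmxBl mulmx1 mul1mx !opprB !addrA; apply/eqP.
  rewrite -subr_eq0; apply/eqP.
  rewrite !opprD !opprK.
  by apply/matrixP => i j; rewrite !mxE; ring.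
apply: le_trans (froD _ _) _.
rewrite -[X in _ <= X * _](subrK 1) mulrDl mul1r lerD2r.
exact: fro_comm_exptail.
Qed.

(* If [A] commutes with [expm X], then up to sign [A *m X - X *m A] is the
   commutator of [A] with the tail [expm X - 1%:M - X], which is smaller by the
   factor [expR (fro X) - 1 < 1]. *)
Lemma comm_expm_small A X : fro X < ln 2 -> A *m expm X = expm X *m A ->
  A *m X = X *m A.
Proof.
move=> Xs AX; have e2 : expR (fro X) < 2.
  have := Xs; rewrite -ltr_expR lnK// posrE; lra.
have := fro_comm_exptail A (lexx (fro X)) (lexx (fro X)).
have -> : A *m (expm X - 1%:M - X) - (expm X - 1%:M - X) *m A = X *m A - A *m X.
  rewrite !mulmxBr !mulmxBl AX mulmx1 mul1mx.
  by apply/matrixP => i j; rewrite !mxE; ring.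
rewrite froBC => h; apply/eqP; rewrite -subr_eq0; apply/eqP/fro_eq0.
have := fro_ge0 (A *m X - X *m A); nra.
Qed.

(** [fro_comm_expm] with [A = 1%:M] is a Lipschitz bound for [expm] on the ball of radius
    [fro a + 1], which eventually contains [f x]. *)
Lemma mxcvg_expm T (F : set_system T) (FF : Filter F) (f : T -> 'M[R]_q) a :
  mxcvg F f a -> mxcvg F (fun x => expm (f x)) (expm a).
Proof.
move=> fa; apply: (@mxcvg_le _ _ _ _ _ _ _ _
    (fun x => expR (fro a + 1) * fro (f x - a))); last first.
  rewrite -(mulr0 (expR (fro a + 1))); apply: cvgM; first exact: cvg_cst.
  by apply/mxcvgP.
have : \forall x \near F, fro (f x) <= fro a + 1.
  by apply: (cvgr_le (fro a)); [exact: cvg_fro|rewrite ltrDl].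
apply: filterS => x fx.
have := fro_comm_expm 1%:M fx (_ : fro a <= fro a + 1).
by rewrite !mul1mx !mulmx1 lerDl => ->.
Qed.

End MatrixExponential.

Lemma expm_ortho (R : realType) q (X : 'M[R]_q) :
  X^T = - X -> (expm X)^T *m expm X = 1%:M.
Proof. by rewrite -expm_tr => ->; exact: expmNK. Qed.

Lemma expm_ortho' (R : realType) q (X : 'M[R]_q) :
  X^T = - X -> expm X *m (expm X)^T = 1%:M.
Proof. by move=> /expm_ortho /mulmx1C. Qed.

(** * Subspaces of matrices and first-order conditions *)

(** A cluster point along an ultrafilter is a limit. Ultrafilters take the place of subsequences, so
    that several bounded sequences converge along one and the same filter. *)
Lemma ultra_cvg_bounded (R : realType) T (G : set_system T) (u : T -> R) (b : R) :
  UltraFilter G -> (forall x, `|u x| <= b) -> exists l : R, u x @[x --> G] --> l.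
Proof.
move=> UG ub; have PG : ProperFilter G by exact: ultra_proper.
have Gb : G (u @^-1` `[- b, b]).
  by apply: filterE => x /=; rewrite in_itv/= -ler_norml.
have [p [_ pcl]] := @segment_compact R (- b) b (u x @[x --> G]) _ Gb.
exists p => B pB; case: (in_ultra_setVsetC (u @^-1` B) UG) => // GB.
by have [y []] := pcl (~` B) B GB pB.
Qed.

Lemma ultra_mxcvg_bounded (R : realType) T (G : set_system T) m n
    (f : T -> 'M[R]_(m, n)) (b : R) :
  UltraFilter G -> (forall x, fro (f x) <= b) -> exists l, mxcvg G f l.
Proof.
move=> UG fb.
have /choice[l fl] (p : 'I_m * 'I_n) : exists l : R, f x p.1 p.2 @[x --> G] --> l.
  apply: (@ultra_cvg_bounded _ _ _ _ b) => // x.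
  exact: le_trans (norm_entry_le_fro _ _ _) (fb x).
by exists (\matrix_(i, j) l (i, j)) => i j; rewrite mxE; exact: fl (i, j).
Qed.

Lemma dot_mxvec (R : realType) m n (A B : 'M[R]_(m, n)) :
  dot A B = dot (mxvec A) (mxvec B).
Proof.
rewrite dotE_pair dotE big_ord1.
rewrite (reindex (uncurry (@mxvec_index m n))) /=; last exact: curry_mxvec_bij.
by apply: eq_bigr => -[i j] _ /=; rewrite !mxvecE.
Qed.

Lemma dot_row (R : realType) n (u v : 'rV[R]_n) : u *m v^T = (dot u v)%:M.
Proof.
by rewrite [LHS]mx11_scalar -trace_mx11 dotC /dot mxtrace_mulC.
Qed.

Section Subspace.
Variables (R : realType) (q : nat) (L : 'M[R]_q -> Prop).
Hypothesis L0 : L 0.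
Hypothesis LD : forall X Y, L X -> L Y -> L (X + Y).
Hypothesis LZ : forall r X, L X -> L (r *: X).

Lemma subspace_rows r (B : 'M[R]_(r, q * q)) (v : 'rV_r) :
  (forall i, L (vec_mx (row i B))) -> L (vec_mx (v *m B)).
Proof.
move=> LB; rewrite mulmx_sum_row raddf_sum/=.
by apply: (big_ind L) => // i _; rewrite linearZ/=; exact: LZ.
Qed.

(* A maximal orthonormal family in [L] spans it, since the component of an
   element of [L] orthogonal to the family could otherwise be adjoined. *)
Lemma subspace_orthobasis : exists r (B : 'M[R]_(r, q * q)),
  [/\ B *m B^T = 1%:M, forall i, L (vec_mx (row i B)) &
      forall V, L V -> mxvec V = mxvec V *m B^T *m B].
Proof.
pose P r := `[< exists B : 'M[R]_(r, q * q),
  B *m B^T = 1%:M /\ forall i, L (vec_mx (row i B)) >].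
have P0 : exists r, P r.
  exists 0%N; apply/asboolP; exists 0; split; first by apply/matrixP => -[].
  by case.
have Pb r : P r -> (r <= q * q)%N by move=> /asboolP[B [/mulmx1_min]].
case: (ex_maxnP P0 Pb) => r /asboolP[B [BB LB]] rmax.
exists r, B; split => // V LV; apply/eqP; rewrite -subr_eq0; apply/negP => /negP w0.
set w := mxvec V - _ in w0.
have Lw : L (vec_mx w).
  rewrite /w linearB/= mxvecK -scaleN1r; apply: LD => //; apply: LZ.
  exact: subspace_rows.
have wB : w *m B^T = 0 by rewrite /w mulmxBl -!mulmxA BB mulmx1 subrr.
have w_gt0 := fro_gt0 w0.
pose u := (fro w)^-1 *: w.
have uB : u *m B^T = 0 by rewrite -scalemxAl wB scaler0.
have : P (r + 1)%N.
  apply/asboolP; exists (col_mx B u); split.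
    rewrite tr_col_mx mul_col_row BB uB.
    have -> : B *m u^T = 0 by apply: trmx_inj; rewrite trmx_mul trmxK uB trmx0.
    rewrite dot_row /u dotZl dotZr -sqr_fro mulrA -invfM -expr2.
    rewrite mulVf ?sqrf_eq0 ?gt_eqF//.
    by rewrite scalar_mx_block.
  move=> i; case: (split_ordP i) => j ->; first by rewrite rowKu.
  by rewrite rowKd row_id linearZ/=; exact: LZ.
by move=> /rmax; rewrite addn1 ltnn.
Qed.

(** [s] is the orthogonal projection of [S] on [L]: in coordinates it is multiplication by
    [B^T *m B], which is self-adjoint and fixes the vectors of [L]. *)
Lemma subspace_proj S : exists2 s, L s & forall V, L V -> dot S V = dot s V.
Proof.
have [r [B [BB LB VB]]] := subspace_orthobasis.
exists (vec_mx (mxvec S *m B^T *m B)); first exact: subspace_rows.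
move=> V /VB LV; rewrite (dot_mxvec S V) (dot_mxvec (vec_mx _) V) vec_mxK LV.
have dotB (x y : 'rV[R]_(q * q)) : dot (x *m B^T *m B) y = dot x (y *m B^T *m B).
  by rewrite dotMr [RHS]dotC [RHS]dotMr dotC.
by rewrite [RHS]dotB -(mulmxA (_ *m B^T) B) BB mulmx1.
Qed.

(** With [s] the projection of the limit [l], the residual [l - s] is orthogonal to every [f x],
    hence to [l] in the limit, and also to [s]; so it is orthogonal to itself. *)
Lemma subspace_closed T (F : set_system T) (FF : ProperFilter F)
    (f : T -> 'M[R]_q) l :
  mxcvg F f l -> (forall x, L (f x)) -> L l.
Proof.
move=> fl Lf; have [s Ls Ss] := subspace_proj l.
suff : l - s = 0 by move=> /eqP; rewrite subr_eq0 => /eqP ->.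
have ortho V : L V -> dot V (l - s) = 0.
  by move=> LV; rewrite dotC dotBl Ss// subrr.
have l0 : dot l (l - s) = 0.
  have cst : mxcvg F (fun=> l - s) (l - s) by exact: mxcvg_cst.
  have : dot (f x) (l - s) @[x --> F] --> dot l (l - s) by exact: cvg_dot.
  under eq_cvg do rewrite ortho//.
  by move=> /(cvg_unique (@norm_hausdorff _ _)); apply; exact: cvg_cst.
by apply: dot_eq0; rewrite dotBl l0 ortho// subr0.
Qed.

End Subspace.

(** Fermat's rule, with a derivative replaced by a quadratic error bound on the unit interval. *)
Lemma first_order_max (R : realFieldType) (phi : R -> R) (a C : R) :
  (forall e, `|e| <= 1 -> `|phi e - phi 0 - e * a| <= C * e ^+ 2) ->
  (forall e, phi e <= phi 0) -> a = 0.
Proof.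
move=> dphi phimax; apply/eqP/negPn/negP => a0.
(* The test point is [t * a]: this [t] keeps it in the unit interval and makes the gain [t * a ^+ 2]
   exceed the error [C * (t * a) ^+ 2]. *)
pose t := (`|a| + 2 * `|C| + 1)^-1.
have den_gt0 : 0 < `|a| + 2 * `|C| + 1 by rewrite ltr_wpDl// addr_ge0// mulr_ge0.
have t_gt0 : 0 < t by rewrite invr_gt0.
have at1 : `|a| * t <= 1.
  by rewrite ler_pdivrMr// mul1r; have := normr_ge0 C; lra.
have Ct : `|C| * t < 1.
  by rewrite ltr_pdivrMr// mul1r; have := normr_ge0 C; have := normr_ge0 a; lra.
have : `|t * a| <= 1 by rewrite normrM (gtr0_norm t_gt0) mulrC.
move=> /dphi; rewrite ler_norml => /andP[h1 _].
have h2 := phimax (t * a).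
have a2 : 0 < t * a ^+ 2 by rewrite mulr_gt0// exprn_even_gt0.
have h3 : t * a ^+ 2 <= C * (t * a) ^+ 2 by rewrite expr2; lra.
have h4 : C * (t * a) ^+ 2 <= `|C| * t * (t * a ^+ 2).
  rewrite [leRHS](_ : _ = `|C| * (t * a) ^+ 2); last by ring.
  by rewrite ler_wpM2r ?sqr_ge0// ler_norm.
have h5 : `|C| * t * (t * a ^+ 2) < 1 * (t * a ^+ 2) by rewrite ltr_pM2r.
lra.
Qed.

(** * First-order expansions of exponentials and of conjugations *)

Section FirstOrder.
Variables (R : realType) (q : nat).
Implicit Types E G S V : 'M[R]_q.

Lemma fro_exp1 V (e : R) : `|e| <= 1 ->
  fro (expm (e *: V) - 1%:M - e *: V) <= fro V ^+ 2 * expR (fro V) * e ^+ 2.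
Proof.
move=> e1; apply: le_trans (fro_exptail _) _.
rewrite froZ exprMn real_normK ?num_real// [leRHS]mulrAC [e ^+ 2 * _]mulrC.
apply: ler_wpM2l; first by rewrite mulr_ge0 ?sqr_ge0.
by rewrite ler_expR ler_piMl.
Qed.

Lemma dot_exp1 V S (e : R) : `|e| <= 1 ->
  `|dot (expm (e *: V)) S - dot 1%:M S - e * dot V S| <=
  fro V ^+ 2 * expR (fro V) * fro S * e ^+ 2.
Proof.
move=> e1; rewrite -dotZl -!dotBl; apply: le_trans (dot_le _ _) _.
by rewrite mulrAC ler_wpM2r// fro_exp1.
Qed.

(** The derivative at 0 of the conjugation of [E] by [expm (e *: V)] is the bracket of [V] and
    [E]. *)
Lemma dot_exp_conj E V S : exists C, forall e : R, `|e| <= 1 ->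
  `|dot (expm (e *: V) *m E *m expm (- (e *: V))) S - dot E S
    - e * dot (V *m E - E *m V) S| <= C * e ^+ 2.
Proof.
pose v := fro V; pose c := v ^+ 2 * expR v.
have c0 : 0 <= c by rewrite mulr_ge0 ?sqr_ge0 ?expR_ge0.
exists ((c + c + (v + c) * (v + c)) * fro E * fro S) => e e1.
have ee : `|e| * `|e| = e ^+ 2 by rewrite -expr2 real_normK ?num_real.
have eE : e ^+ 2 <= `|e| by rewrite -ee ler_piMl.
set a := expm (e *: V); set b := expm (- (e *: V)).
have ra : fro (a - 1%:M - e *: V) <= c * e ^+ 2 by exact: fro_exp1.
have rb : fro (b - 1%:M + e *: V) <= c * e ^+ 2.
  have := @fro_exp1 V (- e); rewrite normrN sqrrN scaleNr opprK; exact.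
have fa : fro (a - 1%:M) <= `|e| * (v + c).
  apply: le_trans (fro_leB _ (e *: V)) _; rewrite froZ mulrDr lerD2l.
  by apply: le_trans ra _; rewrite mulrC ler_wpM2r.
have fb : fro (b - 1%:M) <= `|e| * (v + c).
  apply: le_trans (fro_leB _ (- (e *: V))) _; rewrite froN froZ mulrDr lerD2l opprK.
  by apply: le_trans rb _; rewrite mulrC ler_wpM2r.
rewrite -dotZl -!dotBl; apply: le_trans (dot_le _ _) _.
rewrite [leRHS]mulrAC ler_wpM2r//.
(* Two remainders of second order, and a product of two differences of first order. *)
have -> : a *m E *m b - E - e *: (V *m E - E *m V) =
    (a - 1%:M - e *: V) *m E + E *m (b - 1%:M + e *: V) +
    (a - 1%:M) *m E *m (b - 1%:M).
  rewrite !(mulmxBl, mulmxBr, mulmxDl, mulmxDr, mul1mx, mulmx1).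
  rewrite -!scalemxAl -!scalemxAr scalerBr.
  by apply/matrixP => i j; rewrite !mxE; ring.
apply: le_trans (froD _ _) _; rewrite -mulrA [fro E * _]mulrC mulrA !mulrDl.
apply: lerD; last first.
  apply: le_trans (froM _ _) _.
  have := ler_pM (fro_ge0 _) (fro_ge0 _) fa fb.
  rewrite mulrACA ee => h.
  apply: le_trans (ler_wpM2r _ (froM _ _)) _ => //.
  rewrite [leLHS]mulrAC; apply: le_trans (ler_wpM2r _ h) _ => //.
  by rewrite le_eqVlt; apply/orP; left; apply/eqP; clearbody c v; ring.
apply: le_trans (froD _ _) _; apply: lerD.
  by apply: le_trans (froM _ _) _; rewrite ler_wpM2r.
by apply: le_trans (froM _ _) _; rewrite mulrC ler_wpM2r.
Qed.

End FirstOrder.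

(** * Energy of a product of exponentials *)

Lemma big_nat_split (T : Type) (idx : T) (op : Monoid.law idx) N k (F : nat -> T) :
  (k < N)%N ->
  \big[op/idx]_(0 <= i < N) F i =
  op (\big[op/idx]_(0 <= i < k) F i) (op (F k) (\big[op/idx]_(k.+1 <= i < N) F i)).
Proof.
by move=> kN; rewrite (@big_cat_nat _ _ _ k)//= ?(ltnW kN)// (big_ltn kN).
Qed.

Definition upd (T : Type) (X : nat -> T) k V i := if i == k then V else X i.

Lemma big_nat_upd (S T : Type) (idx : T) (op : Monoid.law idx) N k
    (F : nat -> S -> T) (X : nat -> S) V : (k < N)%N ->
  \big[op/idx]_(0 <= i < N) F i (upd X k V i) =
  op (\big[op/idx]_(0 <= i < k) F i (X i))
     (op (F k V) (\big[op/idx]_(k.+1 <= i < N) F i (X i))).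
Proof.
move=> kN; rewrite (big_nat_split _ _ kN) {2}/upd eqxx.
congr (op _ (op _ _)); apply: eq_big_nat => i /andP[ai bi]; rewrite /upd.
  by rewrite ltn_eqF.
by rewrite gtn_eqF.
Qed.

Lemma mxcvg_prod (R : realType) q T (F : set_system T) (FF : Filter F)
    (r : seq nat) (f : nat -> T -> 'M[R]_q) l :
  (forall k, mxcvg F (f k) (l k)) ->
  mxcvg F (fun x => \prod_(k <- r) f k x) (\prod_(k <- r) l k).
Proof.
move=> fl; elim: r => [|k r ih].
  rewrite big_nil (_ : (fun _ => _) = fun=> 1); first exact: mxcvg_cst.
  by apply/funext => x; rewrite big_nil.
rewrite big_cons (_ : (fun _ => _) = fun x => f k x *m \prod_(k <- r) f k x).
  exact: mxcvgM.
by apply/funext => x; rewrite big_cons.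
Qed.

(** * Orthogonal matrices and products of exponentials *)

Section OrthogonalMatrices.
Variables (R : realType) (q : nat).
Implicit Types P g : 'M[R]_q.

Lemma dot_ortho P : P^T *m P = 1%:M -> dot P P = q%:R.
Proof. by rewrite /dot => ->; rewrite mxtrace1. Qed.

Lemma sqr_fro_orthoB P g : P^T *m P = 1%:M -> g^T *m g = 1%:M ->
  fro (P - g) ^+ 2 = 2 * (q%:R - dot P g).
Proof.
move=> PP gg; rewrite sqr_fro dotBl !dotBr (dotC g P) !dot_ortho//; ring.
Qed.

Lemma dot_ortho_le P g : P^T *m P = 1%:M -> g^T *m g = 1%:M ->
  dot P g <= q%:R.
Proof.
by move=> PP gg; have := sqr_ge0 (fro (P - g)); rewrite sqr_fro_orthoB//; lra.
Qed.

Definition eprod (X : nat -> 'M[R]_q) a b : 'M[R]_q :=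
  \prod_(a <= i < b) expm (X i).

Lemma eprod_ortho X a b : (forall k, (X k)^T = - X k) ->
  (eprod X a b)^T *m eprod X a b = 1%:M.
Proof.
move=> Xskew; rewrite /eprod.
apply: (big_ind (fun P : 'M[R]_q => P^T *m P = 1%:M)).
- by rewrite trmx1 mul1mx.
- move=> P Q PP QQ; rewrite -[P * Q]/(P *m Q) trmx_mul mulmxA -(mulmxA Q^T) PP mulmx1.
  exact: QQ.
- by move=> k _; exact: expm_ortho.
Qed.

Lemma eprod_collinear X (w : nat -> R) s a b :
  (forall k, (a <= k < b)%N -> X k = w k *: s) ->
  eprod X a b = expm ((\sum_(a <= k < b) w k) *: s).
Proof.
move=> Xw; have [ba|/ltnW ab] := leqP b a.
  by rewrite /eprod !big_geq// scale0r expm0.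
rewrite -(subnKC ab) in Xw *; elim: (b - a)%N Xw => [|n ih] Xw.
  by rewrite addn0 /eprod !big_geq// scale0r expm0.
rewrite addnS /eprod !big_nat_recr ?leq_addr//= -/(eprod X a (a + n)) ih; last first.
  by move=> k /andP[ak kn]; apply: Xw; rewrite ak addnS ltnW.
rewrite Xw ?leq_addr ?addnS//= scalerDl expmD//.
by rewrite -!scalemxAl -!scalemxAr !scalerA mulrC.
Qed.

Lemma eprod_upd X k V N : (k < N)%N ->
  eprod (upd X k V) 0 N = eprod X 0 k *m expm V *m eprod X k.+1 N.
Proof.
move=> kN; rewrite /eprod (big_nat_upd _ (fun=> @expm R q) _ _ kN)/=.
by rewrite -mulmxA.
Qed.

Lemma eprod_split X k N : (k < N)%N ->
  eprod X 0 N = eprod X 0 k *m expm (X k) *m eprod X k.+1 N.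
Proof.
move=> kN; rewrite -eprod_upd//; congr eprod; apply/funext => i.
by rewrite /upd; case: eqP => // ->.
Qed.

Lemma eprodSr X k : eprod X 0 k.+1 = eprod X 0 k *m expm (X k).
Proof. by rewrite /eprod big_nat_recr. Qed.

End OrthogonalMatrices.

(** Topological closedness is not among the axioms: it follows from finite dimension by
    [subspace_closed]. Skewness makes the exponentials orthogonal. *)
Record skew_lie (R : realType) q (L : 'M[R]_q -> Prop) : Prop := SkewLie {
  lie0 : L 0;
  lieD : forall X Y, L X -> L Y -> L (X + Y);
  lieZ : forall r X, L X -> L (r *: X);
  lie_comm : forall X Y, L X -> L Y -> L (X *m Y - Y *m X);
  lie_skew : forall X, L X -> X^T = - X }.

(** * Existence and shape of the energy minimisers *)

Section LieExp.
Variables (R : realType) (q : nat) (L : 'M[R]_q -> Prop).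
Hypothesis lieL : skew_lie L.

Let L0 := lie0 lieL.
Let LD := lieD lieL.
Let LZ := lieZ lieL.
Let Lcomm := lie_comm lieL.
Let Lskew := lie_skew lieL.

Let LB X Y : L X -> L Y -> L (X - Y).
Proof. by move=> LX LY; apply: LD => //; rewrite -scaleN1r; exact: LZ. Qed.

(** The conjugate is the sum of the terms [expconv X A (- X) k], each a multiple of the bracket of
    [X] with the previous one; [L] contains the partial sums and is closed. *)
Lemma lie_Ad X A : L X -> L A -> L (expm X *m A *m expm (- X)).
Proof.
move=> LX LA; apply: (subspace_closed L0 LD LZ _ (@cvg_expconv R q X A (- X))).
move=> N; apply: (big_ind L) => // -[k _] _ /=.
elim: k => [|k ih]; first by rewrite expconv0.
have k_neq0 : (k.+1)%:R != 0 :> R by rewrite pnatr_eq0.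
rewrite -[expconv _ _ _ _]scale1r -(mulVf k_neq0) -scalerA expconvS mulmxN.
by apply: LZ; exact: Lcomm.
Qed.

(** The first sum is the kinetic energy of a discrete path with time steps [w k]. As both matrices
    are orthogonal, the penalty is [K / 2] times the squared distance from the product to [g]; only
    indices below [N] matter. *)
Definition energy N (w : nat -> R) (K : R) (g : 'M[R]_q) (X : nat -> 'M[R]_q) :=
  \sum_(0 <= k < N) fro (X k) ^+ 2 / w k + K * (q%:R - dot (eprod X 0 N) g).

Section Energy.
Variables (N : nat) (w : nat -> R) (K : R) (g : 'M[R]_q).
Hypothesis w_gt0 : forall k, 0 < w k.
Hypothesis K_gt0 : 0 < K.
Hypothesis g_ortho : g^T *m g = 1%:M.

(** The penalty and the other terms are nonnegative. This bounds minimising sequences and makes the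
    factors of a minimiser small. *)
Lemma energy_ge_term X k : (forall k, L (X k)) -> (k < N)%N ->
  fro (X k) ^+ 2 <= w k * energy N w K g X.
Proof.
move=> LX kN; rewrite -ler_pdivrMl// mulrC /energy.
have h : 0 <= K * (q%:R - dot (eprod X 0 N) g).
  rewrite mulr_ge0 ?(ltW K_gt0)// subr_ge0 dot_ortho_le// eprod_ortho// => i.
  exact: Lskew.
have t0 i : 0 <= fro (X i) ^+ 2 / w i by rewrite divr_ge0 ?sqr_ge0 ?(ltW (w_gt0 _)).
apply: le_trans (_ : \sum_(0 <= i < N) fro (X i) ^+ 2 / w i <= _); last first.
  by rewrite lerDl.
by rewrite (big_nat_split _ _ kN)/= addrCA lerDl addr_ge0// sumr_ge0.
Qed.

Lemma energy_ge0 X : (forall k, L (X k)) -> 0 <= energy N w K g X.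
Proof.
move=> LX; rewrite addr_ge0//.
  by rewrite sumr_ge0// => i _; rewrite divr_ge0 ?sqr_ge0 ?(ltW (w_gt0 _)).
rewrite mulr_ge0 ?(ltW K_gt0)// subr_ge0 dot_ortho_le// eprod_ortho// => i.
exact: Lskew.
Qed.

Lemma cvg_energy T (F : set_system T) (FF : Filter F) (f : T -> nat -> 'M[R]_q) l :
  (forall k, mxcvg F (f ^~ k) (l k)) ->
  energy N w K g (f x) @[x --> F] --> energy N w K g l.
Proof.
move=> fl; apply: cvgD.
  apply: (cvg_sumr _ (f := fun k x => fro (f x k) ^+ 2 / w k)) => k.
  apply: cvgM; last exact: cvg_cst.
  by under eq_cvg do rewrite sqr_fro; rewrite sqr_fro; exact: cvg_dot.
apply: cvgM; first exact: cvg_cst.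
apply: cvgB; first exact: cvg_cst.
apply: cvg_dot; last exact: mxcvg_cst.
by apply: (mxcvg_prod _ _ (f := fun k x => expm (f x k))) => k; exact: mxcvg_expm.
Qed.

(** The direct method: a minimising sequence is bounded, its limit along an ultrafilter stays in
    [L], and the energy is continuous. *)
Lemma energy_argmin : exists2 X, (forall k, L (X k)) &
  forall Y, (forall k, L (Y k)) -> energy N w K g X <= energy N w K g Y.
Proof.
pose E := [set energy N w K g Y | Y in [set Y | forall k, L (Y k)]].
have lbE : has_lbound E by exists 0 => _ [Y /= LY <-]; exact: energy_ge0.
have infE : has_inf E by split => //; exists (energy N w K g (fun=> 0)), (fun=> 0).
have /choice[Y HY] (n : nat) : exists Y, (forall k, L (Y k)) /\
    energy N w K g Y <= inf E + n.+1%:R^-1.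
  have [|_ [Y /= LY <-] /ltW ?] := @inf_adherent _ E n.+1%:R^-1 _ infE.
    by rewrite invr_gt0.
  by exists Y.
(* The energy does not control the entries from index [N] on; they are set to 0 so that every
   coordinate is bounded. *)
pose Z n k := if (k < N)%N then Y n k else 0.
have LZn n k : L (Z n k) by rewrite /Z; case: ifP => // _; exact: (HY n).1.
have ZE n : energy N w K g (Z n) <= inf E + n.+1%:R^-1.
  rewrite (_ : energy N w K g (Z n) = energy N w K g (Y n)); first exact: (HY n).2.
  rewrite /energy; have -> : eprod (Z n) 0 N = eprod (Y n) 0 N.
    by apply: eq_big_nat => k /andP[_ kN]; rewrite /Z kN.
  by congr +%R; apply: eq_big_nat => k /andP[_ kN]; rewrite /Z kN.
have [G [UG ooG]] := ultraFilterLemma (eventually_filter : ProperFilter \oo).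
have PG : ProperFilter G by exact: ultra_proper.
have /choice[l Zl] k : exists l, mxcvg G (Z ^~ k) l.
  apply: (@ultra_mxcvg_bounded _ _ _ _ _ _ (Num.sqrt (w k * (inf E + 1)))) => n.
  rewrite -[fro _]ger0_norm// -sqrtr_sqr; apply: ler_wsqrtr.
  have [kN|Nk] := ltnP k N.
    apply: le_trans (energy_ge_term (LZn n) kN) _; rewrite ler_pM2l//.
    by apply: le_trans (ZE n) _; rewrite lerD2l invf_le1 ?ler1n.
  rewrite /Z ltnNge Nk/= fro0 expr0n mulr_ge0 ?(ltW (w_gt0 _))// addr_ge0//.
  by apply: lb_le_inf => //; [exact: infE.1|move=> _ [Y' /= LY' <-]; exact: energy_ge0].
exists l => [k|Y' LY'].
  by apply: (subspace_closed L0 LD LZ _ (Zl k)) => n; exact: LZn.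
apply: le_trans (_ : inf E <= _); last by apply: ge_inf => //; exists Y'.
have harm : (n.+1%:R^-1 : R) @[n --> G] --> (0 : R).
  by move=> A /(@cvg_harmonic R); exact: ooG.
have cvgE : energy N w K g (Z n) - n.+1%:R^-1 @[n --> G] --> energy N w K g l - 0.
  by apply: cvgB => //; exact: cvg_energy.
rewrite -[leLHS]subr0; apply: (cvgr_to_le cvgE); apply: nearW => n.
by rewrite lerBlDr.
Qed.

Lemma energy_upd X k V : (k < N)%N ->
  energy N w K g (upd X k V) - energy N w K g X =
  (fro V ^+ 2 - fro (X k) ^+ 2) / w k +
  K * (dot (eprod X 0 N) g - dot (eprod (upd X k V) 0 N) g).
Proof.
move=> kN; rewrite /energy.
rewrite (big_nat_upd _ (fun i A => fro A ^+ 2 / w i) _ _ kN)/= (big_nat_split _ _ kN)/=.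
move: (dot (eprod (upd X k V) 0 N) g) (dot (eprod X 0 N) g) => d d'.
move: (\sum_(0 <= i < k) _) (\sum_(k.+1 <= i < N) _) => x y.
ring.
Qed.

Opaque energy expm.

(* With [S k] the conjugate of [g P^-1] by the first [k] factors, rotating
   the [k]-th variable shows that [S k] and [S k.+1] have the same projection
   [s] on [L]; hence [s] commutes with each factor, and varying [X k] within
   the centralizer of [X k] identifies [X k / w k] with a multiple of [s]. *)
Lemma energy_argmin_collinear X : (forall k, L (X k)) ->
  (forall Y, (forall k, L (Y k)) -> energy N w K g X <= energy N w K g Y) ->
  (forall k, (k < N)%N -> fro (X k) < ln 2) ->
  exists2 s, L s & forall k, (k < N)%N -> X k = w k *: s.
Proof.
move=> LX Xmin Xsmall.
have Xskew k : (X k)^T = - X k by exact: Lskew.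
have Lupd k V : L V -> forall i, L (upd X k V i).
  by move=> LV i; rewrite /upd; case: eqP.
pose P := eprod X 0 N; pose A k := eprod X 0 k; pose B k := eprod X k.+1 N.
pose E k := expm (X k); pose g' k := (A k)^T *m (g *m (B k)^T).
pose S k := (A k)^T *m (g *m P^T) *m A k.
have EE k : (E k)^T *m E k = 1%:M by exact: expm_ortho.
have EE' k : E k *m (E k)^T = 1%:M by exact: expm_ortho'.
have PE k : (k < N)%N -> P = A k *m E k *m B k by exact: eprod_split.
have dotg' k M : dot (A k *m M *m B k) g = dot M (g' k) by rewrite dotMr dotMl.
have PA k : (k < N)%N -> P^T *m A k = (B k)^T *m (E k)^T.
  move=> kN; rewrite (PE k)// !trmx_mul -!mulmxA eprod_ortho//.
  by rewrite mulmx1.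
have Sl k : (k < N)%N -> S k = g' k *m (E k)^T.
  by move=> kN; rewrite /S /g' -!mulmxA PA.
have Sr k : (k < N)%N -> S k.+1 = (E k)^T *m g' k.
  move=> kN; rewrite /S /g' /A eprodSr -/(A k) -/(E k) trmx_mul -!mulmxA.
  by rewrite (mulmxA P^T) PA// -(mulmxA (B k)^T) EE mulmx1.
have upd_dot k V : (k < N)%N -> dot (eprod (upd X k V) 0 N) g = dot (expm V) (g' k).
  by move=> kN; rewrite eprod_upd// dotg'.
have P_dot k : (k < N)%N -> dot P g = dot (E k) (g' k).
  by move=> kN; rewrite (PE k)// dotg'.
(* Replace [X k] by its conjugate under [expm (e *: V)]. Its norm is unchanged, so only the penalty
   varies, and the derivative of the inner product with [g] is [dot V (S k) - dot V (S k.+1)]. *)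
have varA k V : (k < N)%N -> L V -> dot V (S k) = dot V (S k.+1).
  move=> kN LV; have [C HC] := dot_exp_conj (E k) V (g' k).
  apply/eqP; rewrite -subr_eq0 Sl// Sr// -dotMr -dotMl -dotBl; apply/eqP.
  pose phi e := dot (expm (e *: V) *m E k *m expm (- (e *: V))) (g' k).
  have phi0 : phi 0 = dot (E k) (g' k).
    by rewrite /phi scale0r oppr0 expm0 mul1mx mulmx1.
  apply: (@first_order_max _ phi _ C) => [e e1|e]; first by rewrite phi0; exact: HC.
  have LeV := LZ e LV.
  pose Y := expm (e *: V) *m X k *m expm (- (e *: V)).
  have LY : L Y by exact: lie_Ad.
  have := Xmin _ (Lupd k Y LY); rewrite -subr_ge0 (energy_upd X Y kN).
  have -> : fro Y = fro (X k).
    rewrite fro_orthoMr; first by rewrite fro_orthoMl// expm_ortho// Lskew.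
    by rewrite expm_ortho'// linearN/= Lskew// opprK.
  rewrite subrr mul0r add0r (pmulr_rge0 _ K_gt0) subr_ge0.
  rewrite (upd_dot _ _ kN) (P_dot _ kN) phi0.
  by rewrite (expm_conj _ (expmNK _)).
have [s Ls Ss] := subspace_proj L0 LD LZ (S 0).
have sS k V : (k <= N)%N -> L V -> dot V (S k) = dot V s.
  move=> + LV; elim: k => [|k ih] kN; first by rewrite dotC Ss// dotC.
  by rewrite -varA// ih// ltnW.
(* The conjugate [D] of [s] by [E k] lies in [L]; hence [dot D s = dot D (S k) = dot s (S k.+1) =
   dot s s]. As [D] and [s] have equal norms, [D = s]. *)
have sE k : (k < N)%N -> s *m E k = E k *m s.
  move=> kN; pose D := E k *m s *m (E k)^T.
  have LD' : L D.
    have := lie_Ad (LX k) Ls; rewrite -Xskew expm_tr; exact.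
  have Ds : dot D s = dot s s.
    rewrite -(sS k)// ?(ltnW kN)// -[RHS](sS k.+1)//.
    rewrite Sl// Sr// /D dotMr trmxK -mulmxA EE mulmx1.
    by rewrite dotMl.
  have DD : dot D D = dot s s.
    have DE : fro D = fro s.
      by rewrite /D fro_orthoMr ?trmxK ?EE// fro_orthoMl ?EE.
    by rewrite -!sqr_fro DE.
  have : D - s = 0.
    by apply: dot_eq0; rewrite dotBl !dotBr (dotC s D) Ds DD; ring.
  move=> /eqP; rewrite subr_eq0 => /eqP {1}<-.
  by rewrite /D -mulmxA EE mulmx1.
exists ((K / 2) *: s) => [|k kN]; first exact: LZ.
have sX : s *m X k = X k *m s by apply: comm_expm_small; [exact: Xsmall|exact: sE].
(* [V] is the difference to be shown zero. It commutes with [X k], so moving [X k] along [V]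
   multiplies the factor [E k] by [expm (e *: V)]; stationarity then reads [dot V V = 0]. *)
pose V : 'M[R]_q := (w k)^-1 *: X k - (K / 2) *: s.
have LV : L V by apply: LB; exact: LZ.
have VX : X k *m V = V *m X k.
  by rewrite /V mulmxBr mulmxBl -!scalemxAl -!scalemxAr sX.
(* Up to a constant, minus the energy of the varied tuple, hence maximal at 0. *)
pose phi e := K * dot (expm (e *: V)) (S k.+1)
  - (fro (X k + e *: V) ^+ 2 - fro (X k) ^+ 2) / w k.
have phi0 : phi 0 = K * dot 1%:M (S k.+1).
  by rewrite /phi scale0r expm0 addr0 subrr mul0r subr0.
have froXV (W : 'M[R]_q) e : fro (X k + e *: W) ^+ 2 - fro (X k) ^+ 2 =
    e * (2 * dot (X k) W) + e ^+ 2 * dot W W.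
  by rewrite !sqr_fro dotDl !dotDr !dotZl !dotZr (dotC W (X k)); ring.
pose C := K * (fro V ^+ 2 * expR (fro V) * fro (S k.+1)) + dot V V / w k.
have a0 : K * dot V (S k.+1) - 2 * dot (X k) V / w k = 0.
  apply: (@first_order_max _ phi _ C) => [e e1|e].
    rewrite phi0 /phi froXV.
    rewrite [X in `|X|](_ : _ =
      K * (dot (expm (e *: V)) (S k.+1) - dot 1%:M (S k.+1) - e * dot V (S k.+1))
      - dot V V / w k * e ^+ 2); last by ring.
    apply: le_trans (ler_normB _ _) _; rewrite /C mulrDl; apply: lerD.
      by rewrite normrM (gtr0_norm K_gt0) -[leRHS]mulrA (ler_pM2l K_gt0) dot_exp1.
    by rewrite ger0_norm// mulr_ge0 ?sqr_ge0// divr_ge0 ?dot_ge0 ?ltW.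
  have LeV := LZ e LV.
  have := Xmin _ (Lupd k _ (LD (LX k) LeV)); rewrite -subr_ge0 (energy_upd X _ kN).
  have XeV : X k *m (e *: V) = e *: V *m X k by rewrite -scalemxAl -scalemxAr VX.
  rewrite (upd_dot _ _ kN) (P_dot _ kN) (expmD XeV).
  rewrite -/(E k) dotMl -(Sr _ kN) -[in dot (E k) _](mulmx1 (E k)) dotMl -(Sr _ kN).
  rewrite phi0 /phi; lra.
have : dot V V = 0.
  rewrite {2}/V dotBr !dotZr -(sS k.+1)// (dotC V (X k)).
  have := a0; have : w k != 0 by rewrite gt_eqF.
  move=> w0 a0'; rewrite mulrC.
  have : dot (X k) V / w k = K / 2 * dot V (S k.+1) by lra.
  by move=> ->; rewrite subrr.
move=> /dot_eq0 /eqP; rewrite subr_eq0 => /eqP <-.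
by rewrite scalerA divff ?gt_eqF// scale1r.
Qed.

Transparent energy expm.

End Energy.
End LieExp.

(** * Products of exponentials in a Lie algebra *)

Section LieExpProduct.
Variables (R : realType) (q : nat) (L : 'M[R]_q -> Prop).
Hypothesis lieL : skew_lie L.

(** At [X0] the penalty vanishes, so the minimum is at most [E0]; by the last hypothesis all factors
    of a minimiser have norm below [ln 2], hence they are [w k *: s]. With [W] the sum of the
    weights, [Z = W *: s] and the kinetic part is [W * fro s ^+ 2 <= E0]. *)
Lemma lie_exp_shorten N (w : nat -> R) (K : R) (X0 : nat -> 'M[R]_q) (E0 : R) :
  (forall k, 0 < w k) -> 0 < K -> (forall k, L (X0 k)) ->
  E0 = \sum_(0 <= k < N) fro (X0 k) ^+ 2 / w k ->
  (forall k, (k < N)%N -> w k * E0 < ln 2 ^+ 2) ->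
  exists Z, [/\ L Z, fro Z ^+ 2 <= E0 * \sum_(0 <= k < N) w k &
    K * (q%:R - dot (expm Z) (eprod X0 0 N)) <= E0].
Proof.
move=> w0 K0 LX0 E0E wE; set g := eprod X0 0 N.
have gg : g^T *m g = 1%:M by apply: eprod_ortho => k; exact: lie_skew (LX0 k).
have [X LX Xmin] := energy_argmin lieL N w0 K0 gg.
have XE : energy N w K g X <= E0.
  apply: le_trans (Xmin _ LX0) _.
  by rewrite /energy -/g dot_ortho// subrr mulr0 addr0 E0E.
have [|s Ls Xs] := energy_argmin_collinear lieL w0 K0 LX Xmin.
  move=> k kN; rewrite -(@ltr_pXn2r _ 2) ?nnegrE//; last first.
    by rewrite ln_ge0// ler1n.
  apply: le_lt_trans (energy_ge_term lieL w0 K0 gg LX kN) _.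
  by apply: le_lt_trans (wE k kN); rewrite ler_pM2l.
set W := \sum_(0 <= k < N) w k.
have W0 : 0 <= W by apply: sumr_ge0 => k _; exact/ltW.
have PE : eprod X 0 N = expm (W *: s).
  by apply: eprod_collinear => k /andP[_ kN]; exact: Xs.
have EE : \sum_(0 <= k < N) fro (X k) ^+ 2 / w k = W * fro s ^+ 2.
  rewrite /W mulr_suml; apply: eq_big_nat => k /andP[_ kN].
  by rewrite Xs// froZ gtr0_norm//; field; rewrite gt_eqF.
have d0 : 0 <= K * (q%:R - dot (expm (W *: s)) g).
  rewrite mulr_ge0 ?(ltW K0)// subr_ge0 dot_ortho_le// expm_ortho//.
  by apply: (lie_skew lieL); exact: lieZ.
have ss : 0 <= W * fro s ^+ 2 by rewrite mulr_ge0 ?sqr_ge0.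
move: XE; rewrite /energy PE EE => XE.
exists (W *: s); split; first exact: lieZ.
  rewrite froZ ger0_norm// exprMn expr2 -mulrA [leRHS]mulrC ler_wpM2l//; lra.
lra.
Qed.

(** Compactness: approximate logarithms of bounded norm converge along an ultrafilter to an exact
    one. *)
Lemma lie_exp_limit g (l : R) :
  (forall e : R, 0 < e ->
    exists Z, [/\ L Z, fro (expm Z - g) <= e & fro Z <= l + e]) ->
  exists Z, [/\ L Z, expm Z = g & fro Z <= l].
Proof.
move=> approx.
have /choice[Z HZ] (n : nat) : exists Z, [/\ L Z, fro (expm Z - g) <= n.+1%:R^-1 &
    fro Z <= l + n.+1%:R^-1] by apply: approx; rewrite invr_gt0.
have [G [UG ooG]] := ultraFilterLemma (eventually_filter : ProperFilter \oo).
have PG : ProperFilter G by exact: ultra_proper.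
have inv1 (n : nat) : n.+1%:R^-1 <= 1 :> R by rewrite invf_le1 ?ler1n.
have [Z0 ZZ0] : exists Z0, mxcvg G Z Z0.
  apply: (@ultra_mxcvg_bounded _ _ _ _ _ _ (l + 1)) => n.
  by have [_ _ /le_trans] := HZ n; apply; rewrite lerD2l.
have harm : (n.+1%:R^-1 : R) @[n --> G] --> (0 : R).
  by move=> A /(@cvg_harmonic R); exact: ooG.
have eZ : mxcvg G (fun n => expm (Z n)) (expm Z0) by exact: mxcvg_expm.
exists Z0; split.
- apply: (subspace_closed (lie0 lieL) (lieD lieL) (lieZ lieL) _ ZZ0) => n.
  by have [] := HZ n.
- apply: mxcvg_unique eZ _; apply: (mxcvg_le _ harm).
  by apply: nearW => n; have [] := HZ n.
- have : fro (Z n) - n.+1%:R^-1 @[n --> G] --> fro Z0 - 0.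
    by apply: cvgB => //; exact: cvg_fro.
  rewrite -[leLHS]subr0 => /cvgr_to_le; apply; apply: nearW => n.
  by rewrite lerBlDr; have [] := HZ n.
Qed.

(** The discrete Hopf-Rinow theorem: the path along [X] and then [Y] is cut into [p + p] short
    pieces and replaced by one exponential that is not longer. *)
Lemma lie_expM X Y : L X -> L Y ->
  exists Z, [/\ L Z, expm Z = expm X *m expm Y & fro Z <= fro X + fro Y].
Proof.
move=> LX LY.
(* The zero cases are set aside because the weights below must be positive. *)
have [->|X0] := eqVneq X 0; first by exists Y; rewrite expm0 mul1mx fro0 add0r.
have [->|Y0] := eqVneq Y 0; first by exists X; rewrite expm0 mulmx1 fro0 addr0.
have x0 := fro_gt0 X0; have y0 := fro_gt0 Y0.
set l := fro X + fro Y; have l0 : 0 < l by rewrite addr_gt0.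
have ln0 : 0 < ln 2 ^+ 2 :> R by rewrite exprn_gt0// ln_gt0// ltr1n.
(* [p] is so large that [w k * l <= l * l / p < ln 2 ^+ 2], the smallness condition of
   [lie_exp_shorten]. *)
have [p p0 pl] : exists2 p : nat, (0 < p)%N & l * l / ln 2 ^+ 2 < p%:R.
  exists (Num.bound (l * l / ln 2 ^+ 2)).+1 => //.
  apply: lt_trans (archi_boundP _) _; last by rewrite ltr_nat.
  by apply: divr_ge0; [apply: mulr_ge0; exact: ltW|exact: ltW].
have pR : 0 < p%:R :> R by rewrite ltr0n.
have pn0 : p%:R != 0 :> R by rewrite gt_eqF.
pose D k := if (k < p)%N then X else Y.
(* Weights proportional to the lengths (unit speed): the total weight and the initial energy are
   both [l], whence [fro Z ^+ 2 <= l * l]. *)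
pose w k := fro (D k) / p%:R.
have Dpos k : 0 < fro (D k) by rewrite /D; case: ifP.
have w0 k : 0 < w k by rewrite divr_gt0.
pose T k := p%:R^-1 *: D k.
have LT k : L (T k) by apply: lieZ => //; rewrite /D; case: ifP.
have sumw : \sum_(0 <= k < p + p) w k = l.
  rewrite (@big_cat_nat _ _ _ p)//= ?leq_addr//.
  rewrite (eq_big_nat _ _ (F2 := fun=> fro X / p%:R)); last first.
    by move=> k /andP[_ kp]; rewrite /w /D kp.
  rewrite [X in _ + X](eq_big_nat _ _ (F2 := fun=> fro Y / p%:R)); last first.
    by move=> k /andP[kp _]; rewrite /w /D ltnNge kp.
  rewrite !sumr_const_nat subn0 addnK -!mulrnAr -[p%:R^-1 *+ p]mulr_natr.
  by rewrite mulVf// !mulr1.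
have sumE : l = \sum_(0 <= k < p + p) fro (T k) ^+ 2 / w k.
  rewrite -sumw; apply: eq_bigr => k _.
  rewrite /T froZ ger0_norm ?invr_ge0// /w exprMn.
  by field; rewrite pn0 gt_eqF.
have prodE : eprod T 0 (p + p) = expm X *m expm Y.
  rewrite /eprod (@big_cat_nat _ _ _ p)//= ?leq_addr//.
  rewrite -!/(eprod _ _ _).
  rewrite (@eprod_collinear _ _ _ (fun=> p%:R^-1) X); last first.
    by move=> k /andP[_ kp]; rewrite /T /D kp.
  rewrite (@eprod_collinear _ _ _ (fun=> p%:R^-1) Y); last first.
    by move=> k /andP[kp _]; rewrite /T /D ltnNge kp.
  by rewrite !sumr_const_nat subn0 addnK -[p%:R^-1 *+ p]mulr_natr mulVf// !scale1r.
have small k : (k < p + p)%N -> w k * l < ln 2 ^+ 2.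
  move=> _; rewrite /w mulrAC ltr_pdivrMr// [ltRHS]mulrC -ltr_pdivrMr//.
  apply: le_lt_trans pl; rewrite ler_pM2r ?invr_gt0// ler_pM2r//.
  by rewrite /l /D; case: ifP => _; rewrite ?lerDl ?lerDr ltW.
apply: lie_exp_limit => e e0.
(* With this [K] the penalty bound becomes [fro (expm Z - g) ^+ 2 <= 2 * l / K = e ^+ 2]. *)
have K0 : 0 < 2 * l / e ^+ 2 by rewrite divr_gt0 ?mulr_gt0 ?exprn_gt0.
have [Z [LZ ZW Zg]] := lie_exp_shorten w0 K0 LT sumE small.
exists Z; split => //; last first.
  apply: (@le_trans _ _ l); last by rewrite lerDl ltW.
  rewrite sumw in ZW.
  by rewrite -(@ler_pXn2r _ 2) ?nnegrE ?(ltW l0)// [leRHS]expr2.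
rewrite -(@ler_pXn2r _ 2) ?nnegrE ?(ltW e0)// sqr_fro_orthoB; first last.
- rewrite -prodE; apply: eprod_ortho => k; exact: lie_skew (LT k).
- by apply: expm_ortho; exact: lie_skew LZ.
move: Zg; rewrite prodE; move: (q%:R - _) => d; rewrite mulrAC ler_pdivrMr ?exprn_gt0//.
by rewrite [_ * l * d]mulrAC mulrC ler_pM2l.
Qed.

End LieExpProduct.

(** * The real line *)

Section RealLine.
Variable R : realType.
Implicit Types (a b t : R) (s : seq R) (f : R -> R).

(** Let [c] be the supremum of the points of [[0, T]] where [P] holds. The left hypothesis gives
    [P c], and the right one forbids [c < T]. *)
Lemma real_induction (T : R) (P : R -> Prop) : 0 <= T -> P 0 ->
  (forall t, 0 <= t < T -> P t ->
    exists2 d, 0 < d & forall b, t < b < t + d -> b <= T -> P b) ->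
  (forall t, 0 < t <= T ->
    exists2 d, 0 < d & forall a, t - d < a < t -> 0 <= a -> P a -> P t) ->
  P T.
Proof.
move=> T0 P0 Pright Pleft.
pose E := [set t | 0 <= t <= T /\ P t].
have E0 : E 0 by split; rewrite ?lexx.
have Eub : ubound E T by move=> t [/andP[]].
have Esup : has_sup E by split; [exists 0|exists T].
pose c := sup E.
have c0 : 0 <= c by apply: sup_upper_bound.
have cT : c <= T by apply: ge_sup => //; exists 0.
have Pc : P c.
  have [c_eq0|c_neq0] := eqVneq c 0; first by rewrite c_eq0.
  have [|d d0 Pd] := Pleft c; first by rewrite lt_def c_neq0 c0.
  have [a [/andP[a0 aT] Pa] ca] := sup_adherent d0 Esup.
  have : a <= c by apply: sup_upper_bound => //; split => //; rewrite a0.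
  rewrite le_eqVlt => /predU1P[<-//|ac].
  by apply: (Pd a) => //; rewrite ca.
move: cT; rewrite le_eqVlt => /predU1P[<-//|cT].
have [|d d0 Pd] := Pright c _ Pc; first by rewrite c0.
pose b := Num.min T (c + d / 2).
have cb : c < b by rewrite lt_min cT/= ltrDl divr_gt0.
have bT : b <= T by rewrite ge_min lexx.
have Pb : P b.
  apply: Pd => //; rewrite cb/= gt_min ltrD2l; apply/orP; right; lra.
have : b <= c.
  by apply: sup_upper_bound => //; split => //; rewrite bT (le_trans c0 (ltW cb)).
by rewrite leNgt cb.
Qed.

Lemma at_right_delta t (Q : R -> Prop) : (\forall r \near t^'+, Q r) ->
  exists2 d, 0 < d & forall r, t < r < t + d -> Q r.
Proof.
move=> /nbhs_ballP[d /= d0 Qd]; exists d => // r /andP[tr rd].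
apply: Qd => //; rewrite -ball_normE/= ltr_norml; apply/andP; split; lra.
Qed.

Lemma at_left_delta t (Q : R -> Prop) : (\forall r \near t^'-, Q r) ->
  exists2 d, 0 < d & forall r, t - d < r < t -> Q r.
Proof.
move=> /nbhs_ballP[d /= d0 Qd]; exists d => // r /andP[tr rd].
apply: Qd => //; rewrite -ball_normE/= ltr_norml; apply/andP; split; lra.
Qed.

Lemma seq_isolated t s :
  exists2 d, 0 < d & forall r, 0 < `|r - t| < d -> r \notin s.
Proof.
elim: s => [|x s [d d0 ih]]; first by exists 1.
have [->|xt] := eqVneq x t.
  exists d => // r rd; rewrite inE negb_or ih// andbT.
  by case/andP: rd; rewrite normr_gt0 subr_eq0.
exists (Num.min d `|x - t|) => [|r]; first by rewrite lt_min d0 normr_gt0 subr_eq0.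
rewrite lt_min => /and3P[rt rd rx]; rewrite inE negb_or ih ?rt// andbT.
by apply: contraTneq rx => ->; rewrite ltxx.
Qed.

(** Away from the finite set made of 0, [T] and [s] the function is continuous on an open set; on
    the finite set every subset is measurable. *)
Lemma measurable_fun_continuous_but f (T : R) s :
  (forall t, 0 < t <= T -> t \notin s -> f x @[x --> t] --> f t) ->
  measurable_fun `[0, T] f.
Proof.
move=> fc; pose D : set R := [set` [:: 0, T & s]]; pose O : set R := `]0, T[ `&` ~` D.
have finD : finite_set D by exact: finite_seq.
have measF (B : set R) : B `<=` D -> measurable B.
  move=> BD; apply: countable_measurable; first exact: measurable_set1.
  exact/finite_set_countable/(sub_finite_set BD).
have openO : open O.
  apply: openI; first exact: interval_open.
  apply: closed_openC.
  have /accessible_finite_set_closed closed_fin : accessible_space R.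
    by apply: hausdorff_accessible; exact: norm_hausdorff.
  exact: closed_fin.
have mO : measurable O by apply: measurableI => //; apply: measurableC; exact: measF.
apply: (@measurable_funS _ _ _ _ (O `|` D)).
- by apply: measurableU => //; exact: measF.
- move=> t /=; rewrite in_itv/= => /andP[t0 tT].
  case: (boolP (t \in [:: 0, T & s])) => tD; first by right.
  left; split; last by apply/negP.
  move: tD; rewrite !inE !negb_or => /and3P[t_neq0 t_neqT _].
  by rewrite /= in_itv/= !lt_def t0 tT t_neq0 eq_sym t_neqT.
- apply/measurable_funU => //; first exact: measF.
  split; last by move=> _ B _; apply: measF => t [].
  apply: open_continuous_measurable_fun => // t.
  rewrite inE => -[/=]; rewrite in_itv/= => /andP[t0 tT] /negP.
  rewrite !inE !negb_or => /and3P[_ _ ts]; apply: fc => //.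
  by rewrite t0 ltW.
Qed.

(** The bound by [c] is asked on the open interval only, so jumps at [a] and [b] are harmless. *)
Lemma integral_itv_step f (T a b c : R) : measurable_fun `[0, T] f ->
  (forall t, 0 <= f t) -> 0 <= a -> a < b -> b <= T ->
  (forall r, a < r < b -> c <= f r) ->
  (\int[lebesgue_measure]_(t in `[0%R, a]) (f t)%:E + ((b - a) * c)%:E <=
   \int[lebesgue_measure]_(t in `[0%R, b]) (f t)%:E)%E.
Proof.
move=> mf f0 a0 ab bT cf.
have mfS (D : set R) : measurable D -> D `<=` `[0, T] -> measurable_fun D (EFin \o f).
  by move=> mD DT; apply/measurable_EFinP; apply: measurable_funS mf.
have sub0b : `[0, b] `<=` `[0, T].
  by apply: subset_itvl; rewrite bnd_simp.
have subab : `]a, b] `<=` `[0, b] by apply: subset_itvr; rewrite bnd_simp.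
have split0b : `[0, b]%classic = `[0, a] `|` `]a, b].
  by rewrite -itv_bndbnd_setU// bnd_simp// ltW.
rewrite split0b ge0_integral_setU//=; last 3 first.
- by rewrite -split0b; apply: mfS.
- by move=> x _; rewrite lee_fin.
- apply/disj_setPS => x [] /=; rewrite !in_itv/= => /andP[_ xa] /andP[ax _].
  by move: (lt_le_trans ax xa); rewrite ltxx.
apply: leeD => //.
apply: le_trans (_ : (\int[lebesgue_measure]_(t in `]a, b[) (f t)%:E <= _)%E); last first.
  apply: ge0_subset_integral => //.
  - by apply: mfS => //; exact: subset_trans subab sub0b.
  - by move=> x _; rewrite lee_fin.
  - by apply: subset_itvl; rewrite bnd_simp.
(* [c] may be negative, while the monotonicity used here compares nonnegative functions; hence the
   maximum with 0. *)
apply: le_trans (_ : (\int[lebesgue_measure]_(t in `]a, b[) (cst (Num.max 0 c)%:E) t <= _)%E).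
  rewrite integral_cst//= lebesgue_measure_itv/= lte_fin ab -EFinB -EFinM lee_fin.
  rewrite mulrC; apply: ler_wpM2r; first by rewrite subr_ge0 ltW.
  by rewrite le_max lexx orbT.
apply: ge0_le_integral => //.
- by move=> x _; rewrite lee_fin le_max lexx.
- apply: mfS => //; apply: subset_trans sub0b; apply: subset_trans subab.
  by apply: subset_itvl; rewrite bnd_simp.
- by move=> x /=; rewrite in_itv/= => xab; rewrite lee_fin ge_max f0 cf.
Qed.

(** The scalar mean value theorem for [phi r = dot D (U r - r *: W)], with [D] the matrix to be
    bounded, gives [dot D D = (b - a) * dot D (V c - W)]. *)
Lemma mean_value_fro q (U V : R -> 'M[R]_q) (W : 'M[R]_q) a b (e : R) : a < b ->
  mxcvg a^'+ U (U a) -> mxcvg b^'- U (U b) ->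
  (forall r, a < r < b -> mxcvg (nbhs r) U (U r)) ->
  (forall r, a < r < b ->
    mxcvg (0 : R)^' (fun h : R => h^-1 *: (U (r + h) - U r)) (V r)) ->
  (forall r, a < r < b -> fro (V r - W) <= e) ->
  fro (U b - U a - (b - a) *: W) <= (b - a) * e.
Proof.
move=> ab Ua Ub Uc UV VW; set D := U b - U a - _.
pose phi r := dot D (U r - r *: W).
have phiE : phi b - phi a = dot D D.
  rewrite /phi -dotBr; congr dot; rewrite /D scalerBl.
  by apply/matrixP => i j; rewrite !mxE; ring.
have cphi (F : set_system R) (FF : Filter F) r :
    F --> r -> mxcvg F U (U r) -> phi x @[x --> F] --> phi r.
  move=> Fr FU; apply: cvg_dot; first exact: mxcvg_cst.
  apply: mxcvgB => //; apply: mxcvgZ => //; exact: mxcvg_cst.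
have dphi r : r \in `]a, b[%R -> is_derive r 1 phi (dot D (V r - W)).
  rewrite in_itv/= => rab.
  have H : h^-1 *: ((phi \o shift r) (h *: 1) - phi r) @[h --> (0 : R)^'] -->
      dot D (V r - W).
    have : dot D (h^-1 *: (U (r + h) - U r) - W) @[h --> (0 : R)^'] --> dot D (V r - W).
      apply: cvg_dot; first exact: mxcvg_cst.
      by apply: mxcvgB; [exact: UV|exact: mxcvg_cst].
    apply: cvg_trans; apply: near_eq_cvg; near=> h.
    have h0 : h != 0 by near: h; exact: nbhs_dnbhs_neq.
    rewrite /= /phi -dotBr [h *: 1]mulr1 (addrC h) -[RHS]dotZr; congr dot.
    by apply/matrixP => i j; rewrite !mxE; field.
  apply: DeriveDef; first by apply/cvg_ex; eexists; exact: H.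
  exact: cvg_lim H.
have cw : {within `[a, b], continuous phi}.
  apply/continuous_within_itvP => //; split.
  - move=> r; rewrite in_itv/= => rab; apply: cphi; [exact: cvg_id|exact: Uc].
  - by apply: cphi => //; exact: cvg_within.
  - by apply: cphi => //; exact: cvg_within.
have [c] := MVT ab dphi cw; rewrite in_itv/= phiE => cab DE.
have : fro D ^+ 2 <= fro D * ((b - a) * e).
  rewrite sqr_fro DE mulrCA mulrC ler_pM2l ?subr_gt0//.
  apply: le_trans (ler_norm _) _; apply: le_trans (dot_le _ _) _.
  by rewrite ler_wpM2l// VW.
have [->|D0] := eqVneq (fro D) 0.
  move=> _; apply: mulr_ge0; first by rewrite subr_ge0 ltW.
  exact: le_trans (fro_ge0 _) (VW c cab).
by rewrite expr2 ler_pM2l// lt_def D0 fro_ge0.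
Unshelve. all: by end_near. Qed.

End RealLine.

(** * Propagators of a skew-symmetric equation *)

Section RealPropagation.
Variables (R : realType) (q : nat) (L : 'M[R]_q -> Prop).
Hypothesis lieL : skew_lie L.
Variables (A U : R -> 'M[R]_q) (T : R) (s : seq R) (b0 : R).
Hypothesis T_ge0 : 0 <= T.
Hypothesis LA : forall t : R, L (A t).
Hypothesis A_bounded : forall t : R, 0 <= t -> fro (A t) <= b0.
Hypothesis A_right : forall t : R, 0 <= t < T -> exists l, mxcvg t^'+ A l.
Hypothesis A_left : forall t : R, 0 < t <= T -> exists l, mxcvg t^'- A l.
Hypothesis A_cont : forall t : R, 0 < t <= T -> t \notin s -> mxcvg (nbhs t) A (A t).
Hypothesis U0 : U 0 = 1%:M.
Hypothesis U_right0 : mxcvg (0 : R)^'+ U (U 0).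
Hypothesis U_cont : forall t : R, 0 < t -> mxcvg (nbhs t) U (U t).
Hypothesis U_ode : forall t : R, 0 < t -> mxcvg (nbhs t) A (A t) ->
  mxcvg (0 : R)^' (fun h : R => h^-1 *: (U (t + h) - U t)) (A t *m U t).

Lemma mxcvg_within (D : set R) (t : R) m n (f : R -> 'M[R]_(m, n)) l :
  mxcvg (nbhs t) f l -> mxcvg (within D (nbhs t)) f l.
Proof. by move=> fl i j; apply: cvg_within_filter; exact: fl. Qed.

Lemma U_cvg_right (t : R) : 0 <= t -> mxcvg t^'+ U (U t).
Proof.
rewrite le_eqVlt => /predU1P[<-//|t0]; apply: mxcvg_within; exact: U_cont.
Qed.

Lemma measurable_froA : measurable_fun `[0, T] (fun t => fro (A t)).
Proof.
apply: (@measurable_fun_continuous_but _ _ _ s) => t t0 ts.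
by apply: cvg_fro; exact: A_cont.
Qed.

(** The error constant of [exp_step]: [fro v + 1] bounds [U] and multiplies [A r - l], [2 * fro l]
    comes from [U r - U a], and the rest from the quadratic tail of the exponential. *)
Definition step_const (v l : 'M[R]_q) : R :=
  fro v + 1 + 2 * fro l + fro l ^+ 2 * expR (fro l) * (fro v + 1).

Lemma exp_step (a b : R) (v l : 'M[R]_q) (e : R) :
  0 <= a -> a < b -> b <= T -> e <= 1 -> b - a <= e ->
  (forall r : R, a < r < b -> r \notin s) ->
  (forall r : R, a < r < b -> fro (A r - l) <= e) ->
  (forall r : R, a <= r <= b -> fro (U r - v) <= e) ->
  fro (expm ((b - a) *: l) *m U a - U b) <= (b - a) * (e * step_const v l).
Proof.
move=> a0 ab bT e1 be rs Al Uv; have ba : 0 < b - a by rewrite subr_gt0.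
have e0 : 0 <= e by rewrite (le_trans (ltW ba)).
have aab : a <= a <= b by rewrite lexx ltW.
have Ur r : a <= r <= b -> fro (U r) <= fro v + 1.
  by move=> rab; apply: le_trans (fro_leB _ v) _; rewrite lerD2l (le_trans (Uv r rab)).
have gt0r r : a < r < b -> 0 < r by move=> /andP[ar _]; exact: le_lt_trans ar.
have Ac r : a < r < b -> mxcvg (nbhs r) A (A r).
  move=> rab; apply: A_cont; last exact: rs.
  by rewrite (gt0r r rab)/=; case/andP: rab => _ /ltW /le_trans; apply.
have mv : fro (U b - U a - (b - a) *: (l *m U a)) <=
    (b - a) * (e * (fro v + 1) + 2 * fro l * e).
  apply: (@mean_value_fro _ _ _ (fun r => A r *m U r)) => //.
  - exact: U_cvg_right.
  - by apply: mxcvg_within; apply: U_cont; exact: le_lt_trans ab.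
  - by move=> r /gt0r r0; exact: U_cont.
  - by move=> r rab; apply: U_ode; [exact: gt0r rab|exact: Ac].
  - move=> r rab; have rab' : a <= r <= b by case/andP: rab => ar rb; rewrite !ltW.
    have -> : A r *m U r - l *m U a = (A r - l) *m U r + l *m (U r - U a).
      by rewrite mulmxBl mulmxBr addrA subrK.
    apply: le_trans (froD _ _) _; apply: lerD; apply: le_trans (froM _ _) _.
      by apply: ler_pM => //; [exact: Al|exact: Ur].
    rewrite -mulrA mulrCA ler_wpM2l// mulrDl mul1r.
    apply: le_trans (fro_dist _ v _) _; rewrite lerD ?Uv//.
    by rewrite froBC Uv.
have tl : fro (expm ((b - a) *: l) - 1%:M - (b - a) *: l) <=
    (b - a) * (e * (fro l ^+ 2 * expR (fro l))).
  apply: le_trans (fro_exp1 _ _) _; first by rewrite gtr0_norm// (le_trans be).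
  set c := fro l ^+ 2 * _.
  have c0 : 0 <= c by rewrite mulr_ge0 ?sqr_ge0 ?expR_ge0.
  by rewrite [(b - a) ^+ 2]expr2 [leLHS]mulrC -mulrA ler_pM2l// ler_wpM2r.
have -> : expm ((b - a) *: l) *m U a - U b =
    (expm ((b - a) *: l) - 1%:M - (b - a) *: l) *m U a
    - (U b - U a - (b - a) *: (l *m U a)).
  rewrite !mulmxBl mul1mx -scalemxAl.
  by apply/matrixP => i j; rewrite !mxE; ring.
apply: le_trans (froB _ _) _.
apply: le_trans (lerD (le_trans (froM _ _) (ler_pM _ _ tl (Ur a aab))) mv) _ => //.
rewrite /step_const le_eqVlt; apply/orP; left; apply/eqP; ring.
Qed.

Let I (t : R) := (\int[lebesgue_measure]_(r in `[0%R, t]) (fro (A r))%:E)%E.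

(** Both errors are proportional to time, so that the errors of consecutive steps add up. *)
Definition approximable (e t : R) := exists Z, [/\ L Z,
  fro (expm Z - U t) <= e * t & ((fro Z)%:E <= I t + (e * t)%:E)%E].

(** [lie_expM] merges the step [(b - a) *: l] with [Z]. Left multiplication by an orthogonal matrix
    preserves the earlier error, and [(b - a) * fro l] exceeds the integral over the step by at most
    [(b - a) * d]. *)
Lemma approximable_step (e a b : R) (v l : 'M[R]_q) (d : R) :
  L l -> 0 <= a -> a < b -> b <= T ->
  d <= 1 -> d <= e -> d * step_const v l <= e -> b - a <= d ->
  (forall r : R, a < r < b -> r \notin s) ->
  (forall r : R, a < r < b -> fro (A r - l) <= d) ->
  (forall r : R, a <= r <= b -> fro (U r - v) <= d) ->
  approximable e a -> approximable e b.
Proof.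
move=> Ll a0 ab bT d1 de dC bd rs Al Uv [Z [LZ ZU ZI]].
have ba : 0 < b - a by rewrite subr_gt0.
have LX : L ((b - a) *: l) by exact: lieZ.
have [Z' [LZ' Z'E Z'le]] := lie_expM lieL LX LZ.
exists Z'; split => //.
  have -> : expm Z' - U b = expm ((b - a) *: l) *m (expm Z - U a)
      + (expm ((b - a) *: l) *m U a - U b).
    by rewrite Z'E mulmxBr addrA subrK.
  apply: le_trans (froD _ _) _; rewrite fro_orthoMl; last first.
    by apply: expm_ortho; exact: lie_skew LX.
  have := exp_step a0 ab bT d1 bd rs Al Uv.
  move=> /le_trans /(_ (ler_wpM2l (ltW ba) dC)); lra.
have step : (I a + ((b - a) * (fro l - d))%:E <= I b)%E.
  apply: (@integral_itv_step _ _ T) => //; first exact: measurable_froA.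
  move=> r rab; rewrite lerBlDr; apply: le_trans (fro_leB _ (A r)) _.
  by rewrite lerD2l froBC Al.
have Z'le2 : fro Z' <= (b - a) * fro l + fro Z.
  by apply: le_trans Z'le _; rewrite froZ gtr0_norm.
apply: le_trans (leeD2r _ step); rewrite -addeA -EFinD.
apply: le_trans (_ : ((fro Z)%:E + ((b - a) * fro l)%:E <= _)%E).
  by rewrite -EFinD lee_fin addrC.
apply: le_trans (leeD2r _ ZI) _; rewrite -addeA -EFinD leeD2l// lee_fin.
have : (b - a) * d <= (b - a) * e by rewrite ler_pM2l.
lra.
Qed.

Lemma approximable_const (e : R) v l : 0 < e -> exists2 d : R, 0 < d &
  [/\ d <= 1, d <= e & d * step_const v l <= e].
Proof.
move=> e0; have C0 : 0 <= step_const v l.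
  by rewrite /step_const !addr_ge0// ?mulr_ge0 ?sqr_ge0 ?expR_ge0// addr_ge0.
have D0 : 0 < 1 + e + step_const v l by lra.
exists (e / (1 + e + step_const v l)); first by rewrite divr_gt0.
rewrite !ler_pdivrMr// mul1r mulrAC ler_pdivrMr//.
by split; nra.
Qed.

Lemma approximable_all (e : R) : 0 < e -> approximable e T.
Proof.
move=> e0; apply: real_induction => //.
- exists 0; split; first exact: lie0.
    by rewrite expm0 U0 subrr fro0 mulr0.
  rewrite fro0 mulr0 adde0; apply: integral_ge0 => t _; by rewrite lee_fin.
(* Step to the right of [t]: freeze [A] at its right limit [l], on an interval avoiding the jumps in
   [s]. *)
- move=> t /andP[t0 tT] Pt; have [l Al] := A_right (introT andP (conj t0 tT)).
  have Ll : L l by exact: (subspace_closed (lie0 lieL) (lieD lieL) (lieZ lieL) _ Al).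
  have [d d0 [d1 de dC]] := approximable_const (U t) l e0.
  have [s1 s10 Hs] := seq_isolated t s.
  have [r1 r10 Hr1] : exists2 d' : R, 0 < d' &
      forall r, t < r < t + d' -> fro (A r - l) <= d.
    apply: at_right_delta; apply: (cvgr_le _ _ _ d0); exact/mxcvgP.
  have [r2 r20 Hr2] : exists2 d' : R, 0 < d' &
      forall r, t < r < t + d' -> fro (U r - U t) <= d.
    apply: at_right_delta; apply: (cvgr_le _ _ _ d0); apply/mxcvgP.
    exact: U_cvg_right.
  exists (Num.min d (Num.min s1 (Num.min r1 r2))); first by rewrite !lt_min d0 s10 r10.
  move=> b /andP[tb]; rewrite -ltrBlDl !lt_min => /and4P[bd bs b1 b2] bT.
  apply: (approximable_step Ll t0 tb bT d1 de dC) => //; first exact: ltW.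
  + by move=> r /andP[tr rb]; apply: Hs; rewrite gtr0_norm subr_gt0// tr; lra.
  + by move=> r /andP[tr rb]; apply: Hr1; rewrite tr; lra.
  + move=> r /andP[]; rewrite le_eqVlt => /predU1P[<- _|tr rb].
      by rewrite subrr fro0 ltW.
    by apply: Hr2; rewrite tr; lra.
(* Step reaching [t] from the left: freeze [A] at its left limit, and compare [U] with its value at
   the end point [t]. *)
- move=> t /andP[t0 tT]; have [l Al] := A_left (introT andP (conj t0 tT)).
  have Ll : L l by exact: (subspace_closed (lie0 lieL) (lieD lieL) (lieZ lieL) _ Al).
  have [d d0 [d1 de dC]] := approximable_const (U t) l e0.
  have [s1 s10 Hs] := seq_isolated t s.
  have [r1 r10 Hr1] : exists2 d' : R, 0 < d' &
      forall r, t - d' < r < t -> fro (A r - l) <= d.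
    apply: at_left_delta; apply: (cvgr_le _ _ _ d0); exact/mxcvgP.
  have [r2 r20 Hr2] : exists2 d' : R, 0 < d' &
      forall r, t - d' < r < t -> fro (U r - U t) <= d.
    apply: at_left_delta; apply: (cvgr_le _ _ _ d0); apply/mxcvgP.
    by apply: mxcvg_within; exact: U_cont.
  exists (Num.min d (Num.min s1 (Num.min r1 r2))); first by rewrite !lt_min d0 s10 r10.
  move=> a /andP[]; rewrite ltrBlDr -ltrBlDl !lt_min => /and4P[bd bs b1 b2] ta a0.
  apply: (approximable_step Ll a0 ta tT d1 de dC) => //; first exact: ltW.
  + by move=> r /andP[ar rt]; apply: Hs; rewrite distrC gtr0_norm subr_gt0// rt; lra.
  + by move=> r /andP[ar rt]; apply: Hr1; rewrite rt andbT; lra.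
  + move=> r /andP[ar]; rewrite le_eqVlt => /predU1P[->|rt].
      by rewrite subrr fro0 ltW.
    by apply: Hr2; rewrite rt andbT; lra.
Qed.

(** Boundedness of [A] makes the integral a finite real, so [lie_exp_limit] can let the error tend
    to 0. *)
Lemma real_propagator_log : exists Z, [/\ L Z, expm Z = U T & ((fro Z)%:E <= I T)%E].
Proof.
have I0 : (0 <= I T)%E by apply: integral_ge0 => t _; rewrite lee_fin.
have IT : (I T <= (b0 * T)%:E)%E.
  apply: le_trans (_ : (\int[lebesgue_measure]_(t in `[0%R, T]) cst b0%:E t <= _)%E).
    apply: ge0_le_integral => //.
    - by move=> t _; rewrite lee_fin.
    - by apply/measurable_EFinP; exact: measurable_froA.
    - by move=> t /=; rewrite in_itv/= => /andP[t0 _]; rewrite lee_fin A_bounded.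
  rewrite integral_cst//= lebesgue_measure_itv/= lte_fin.
  move: T_ge0; rewrite le_eqVlt => /predU1P[<-|T0]; first by rewrite ltxx mule0 mulr0.
  by rewrite T0 -EFinB -EFinM subr0.
have If : I T \is a fin_num by rewrite ge0_fin_numE// (le_lt_trans IT) ?ltry.
have [e e0|Z [LZ ZU ZI]] := @lie_exp_limit _ _ _ lieL (U T) (fine (I T)); last first.
  by exists Z; split => //; rewrite -(fineK If) lee_fin.
(* Dividing by [T + 1] also covers [T = 0]. *)
have e'0 : 0 < e / (T + 1) by rewrite divr_gt0// ltr_wpDl.
have e'T : e / (T + 1) * T <= e.
  by rewrite mulrAC ler_pdivrMr ?ltr_wpDl// ler_pM2l// lerDl.
have [Z [LZ ZU ZI]] := approximable_all e'0.
exists Z; split => //; first exact: le_trans ZU _.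
move: ZI; rewrite -(fineK If) -EFinD lee_fin => /le_trans; apply.
by rewrite lerD2l.
Qed.

End RealPropagation.

(** * Realification of complex matrices *)

Section Realification.
Variable R : realType.
Local Notation C := R[i].

(** [x + iy] acts on pairs of real vectors. The map is an injective morphism of real algebras that
    turns adjoints into transposes. *)
Definition realify m n (A : 'M[C]_(m, n)) : 'M[R]_(m + m, n + n) :=
  block_mx (map_mx (@complex.Re R) A) (- map_mx (@complex.Im R) A)
           (map_mx (@complex.Im R) A) (map_mx (@complex.Re R) A).

Lemma realifyD m n (A B : 'M[C]_(m, n)) : realify (A + B) = realify A + realify B.
Proof.
by rewrite /realify add_block_mx -opprD -!map_mxD.
Qed.

Lemma realify0 m n : realify (0 : 'M[C]_(m, n)) = 0.
Proof. by apply: (addrI (realify 0)); rewrite -realifyD !addr0. Qed.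

Lemma realifyN m n (A : 'M[C]_(m, n)) : realify (- A) = - realify A.
Proof. by apply: (addrI (realify A)); rewrite -realifyD !subrr realify0. Qed.

Lemma realifyB m n (A B : 'M[C]_(m, n)) : realify (A - B) = realify A - realify B.
Proof. by rewrite realifyD realifyN. Qed.

Lemma realify_sum m n (I : Type) (r : seq I) (P : pred I) (f : I -> 'M[C]_(m, n)) :
  realify (\sum_(i <- r | P i) f i) = \sum_(i <- r | P i) realify (f i).
Proof. exact: (big_morph _ (@realifyD m n) (realify0 m n)). Qed.

Lemma realifyZ m n (r : R) (A : 'M[C]_(m, n)) : realify (r%:C *: A) = r *: realify A.
Proof.
rewrite /realify scale_block_mx scalerN; congr (block_mx _ (- _) _ _);
  by apply/matrixP => i j; rewrite !mxE; case: (A i j) => x y /=; ring.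
Qed.

Lemma realify_inj m n : injective (@realify m n).
Proof.
move=> A B /eq_block_mx[/matrixP ReAB _ /matrixP ImAB _].
apply/matrixP => i j; have := ReAB i j; have := ImAB i j; rewrite !mxE.
by case: (A i j) (B i j) => x y [x' y'] /= -> ->.
Qed.

Lemma ReM (x y : C) :
  complex.Re (x * y) = complex.Re x * complex.Re y - complex.Im x * complex.Im y.
Proof. by case: x y => [a b] [c d]. Qed.

Lemma ImM (x y : C) :
  complex.Im (x * y) = complex.Re x * complex.Im y + complex.Im x * complex.Re y.
Proof. by case: x y => [a b] [c d]. Qed.

Lemma realifyM m n p (A : 'M[C]_(m, n)) (B : 'M[C]_(n, p)) :
  realify (A *m B) = realify A *m realify B.
Proof.
rewrite /realify mulmx_block mulmxN mulNmx; congr block_mx.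
- apply/matrixP => i j; rewrite !mxE raddf_sum/= -sumrB; apply: eq_bigr => k _.
  by rewrite !mxE ReM.
- rewrite mulNmx -opprD; congr (- _).
  apply/matrixP => i j; rewrite !mxE raddf_sum/= -big_split/=; apply: eq_bigr => k _.
  by rewrite !mxE ImM.
- apply/matrixP => i j; rewrite !mxE raddf_sum/= -big_split/=; apply: eq_bigr => k _.
  by rewrite !mxE ImM addrC.
- rewrite mulmxN addrC; apply/matrixP => i j; rewrite !mxE raddf_sum/= -sumrB.
  by apply: eq_bigr => k _; rewrite !mxE ReM.
Qed.

Lemma realify1 n : realify (1%:M : 'M[C]_n) = 1%:M.
Proof.
rewrite /realify (scalar_mx_block n n); congr block_mx; apply/matrixP => i j;
  by rewrite !mxE; case: (i == j); rewrite ?mulr1n ?mulr0n//= oppr0.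
Qed.

Lemma realifyX n (A : 'M[C]_n.+1) k : realify (A ^+ k) = realify A ^+ k.
Proof.
elim: k => [|k ih]; first by rewrite !expr0 -[1]/(1%:M) realify1.
by rewrite !exprS -mulmxE realifyM ih.
Qed.

Lemma realify_adj n (A : 'M[C]_n) : realify (mxadj A) = (realify A)^T.
Proof.
rewrite /realify tr_block_mx /mxadj; congr block_mx;
  by apply/matrixP => i j; rewrite !mxE; case: (A j i) => x y /=; rewrite ?opprK.
Qed.

(** The two diagonal blocks double the real part of the trace. *)
Lemma fro_realify n (A : 'M[C]_n) : fro (realify A) = Num.sqrt 2 * frob A.
Proof.
rewrite /fro /frob -sqrtrM//; congr Num.sqrt.
rewrite /dot -realify_adj -realifyM /realify mxtrace_block.
have -> : \tr (map_mx (@complex.Re R) (mxadj A *m A)) =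
    complex.Re (\tr (mxadj A *m A)).
  by rewrite /mxtrace raddf_sum; apply: eq_bigr => i _; rewrite mxE.
ring.
Qed.

Lemma frobE n (A : 'M[C]_n) : frob A = (Num.sqrt 2)^-1 * fro (realify A).
Proof. by rewrite fro_realify mulKf// sqrtr_eq0 -ltNge. Qed.

Lemma mx_limP T (F : set_system T) (FF : Filter F) n (f : T -> 'M[C]_n) l :
  mx_lim F f l <-> mxcvg F (fun x => realify (f x)) (realify l).
Proof.
rewrite mxcvgP /mx_lim; split => fl.
  rewrite -(mulr0 (Num.sqrt 2)).
  under eq_cvg do rewrite -realifyB fro_realify.
  by apply: cvgM => //; exact: cvg_cst.
rewrite -(mulr0 (Num.sqrt 2)^-1); under eq_cvg do rewrite frobE realifyB.
by apply: cvgM => //; exact: cvg_cst.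
Qed.

Lemma mxadjD n (A B : 'M[C]_n) : mxadj (A + B) = mxadj A + mxadj B.
Proof. by apply: realify_inj; rewrite realifyD !realify_adj realifyD linearD. Qed.

Lemma mxadjN n (A : 'M[C]_n) : mxadj (- A) = - mxadj A.
Proof. by apply: realify_inj; rewrite realifyN !realify_adj realifyN linearN. Qed.

Lemma mxadjM n (A B : 'M[C]_n) : mxadj (A *m B) = mxadj B *m mxadj A.
Proof. by apply: realify_inj; rewrite realifyM !realify_adj realifyM trmx_mul. Qed.

Lemma mxadjZ n (r : R) (A : 'M[C]_n) : mxadj (r%:C *: A) = r%:C *: mxadj A.
Proof. by apply: realify_inj; rewrite realifyZ !realify_adj realifyZ linearZ. Qed.

Lemma mxadj_iZ n (A : 'M[C]_n) : mxadj ('i *: A) = - ('i *: mxadj A).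
Proof.
apply/matrixP => i j; rewrite !mxE; case: (A j i) => x y.
by apply/eqP; rewrite eq_complex/=; apply/andP; split; apply/eqP; ring.
Qed.

Lemma iiZ n (A : 'M[C]_n) : 'i *: ('i *: A) = - A.
Proof. by rewrite scalerA -expr2 sqr_i scaleN1r. Qed.

Lemma frob_iZ n (A : 'M[C]_n) : frob ('i *: A) = frob A.
Proof.
rewrite /frob mxadj_iZ mulNmx -scalemxAl -scalemxAr iiZ.
by rewrite opprK.
Qed.

Lemma realify_expser n (A : 'M[C]_n.+1) N :
  realify (\sum_(k < N) ((k`!)%:R)^-1 *: A ^+ k) = expser (realify A) N.
Proof.
rewrite realify_sum; apply: eq_bigr => k _; rewrite -realifyX -realifyZ.
congr (realify (_ *: _)).
by rewrite rmorphV ?unitfE ?pnatr_eq0 -?lt0n ?fact_gt0// rmorph_nat.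
Qed.

End Realification.

(** * The dynamical Lie algebra, and return to the complex propagator *)

Section DynamicalLieAlgebra.
Variables (R : realType) (n M : nat) (G : 'I_M -> 'M[R[i]]_n).
Hypothesis G_antiherm : forall m, mxadj (G m) = - G m.

Lemma dla_antiherm X : dla G X -> mxadj X = - X.
Proof.
elim=> {X} [m||X Y _ hX _ hY|r X _ hX|X Y _ hX _ hY]; first exact: G_antiherm.
- by apply: realify_inj; rewrite realify_adj realifyN realify0 trmx0 oppr0.
- by rewrite mxadjD hX hY opprD.
- by rewrite mxadjZ hX scalerN.
- by rewrite mxadjD mxadjN !mxadjM hX hY !(mulNmx, mulmxN) !opprK opprB.
Qed.

Lemma skew_lie_dla : skew_lie (fun Y => exists2 X, dla G X & realify X = Y).
Proof.
split.
- by exists 0; [exact: dla_zero|exact: realify0].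
- move=> _ _ [X gX <-] [Y gY <-]; exists (X + Y); first exact: dla_add.
  exact: realifyD.
- by move=> r _ [X gX <-]; exists (r%:C *: X); [exact: dla_scale|exact: realifyZ].
- move=> _ _ [X gX <-] [Y gY <-]; exists (X *m Y - Y *m X); first exact: dla_comm.
  by rewrite realifyB !realifyM.
- by move=> _ [X gX <-]; rewrite -realify_adj dla_antiherm// realifyN.
Qed.

End DynamicalLieAlgebra.

(* D = n.+1 >= 1; generators H_0, ..., H_M indexed by 'I_M.+1 *)
Theorem theorem1 (R : realType) (n M : nat)
    (Hm : 'I_M.+1 -> 'M[R[i]]_n.+1) (h : 'I_M.+1 -> R -> R)
    (U : R -> 'M[R[i]]_n.+1) :
  (forall m, is_hermitian (Hm m)) ->
  (forall m, exists B : R, forall t : R, 0 <= t -> `|h m t| <= B) ->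
  pw_continuous (hamiltonian Hm h) ->
  solves_schrodinger (hamiltonian Hm h) U ->
  forall T : R, 0 <= T ->
    exists CT : 'M[R[i]]_n.+1,
      [/\ is_hermitian CT,
          mxexp_is (- 'i%C *: CT) (U T),
          dla (fun m => 'i%C *: Hm m) ('i%C *: CT)
        & ((frob CT)%:E <=
             \int[lebesgue_measure]_(t in `[0%R, T]) (frob (hamiltonian Hm h t))%:E)%E].
Proof.
move=> Hherm h_bounded Hpw [U0 U_right U_cont U_ode] T T0.
set H := hamiltonian Hm h in Hpw U_ode *.
pose G m := 'i *: Hm m.
have G_antiherm m : mxadj (G m) = - G m by rewrite mxadj_iZ Hherm.
have lieL := skew_lie_dla G_antiherm.
set L := (fun Y => _) in lieL.
(* The equation becomes [V' = A V] with [V] the realification of [U] and [A] in the realified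
   algebra. *)
pose A t := realify (- 'i *: H t).
(* [J] is multiplication by [i]; it carries limits of [H] to limits of [A] and back, so that both
   have the same continuity points. *)
pose J := realify ('i *: (1%:M : 'M[R[i]]_n.+1)).
have AJ t : A t = - J *m realify (H t).
  by rewrite /A /J -realifyN -realifyM mulNmx -scalemxAl mul1mx scaleNr.
have HJ t : realify (H t) = J *m A t.
  rewrite AJ mulNmx mulmxN mulmxA -realifyM -scalemxAl mul1mx iiZ.
  by rewrite realifyN realify1 mulNmx mul1mx opprK.
have A_sum t : - 'i *: H t = \sum_m (- h m t)%:C *: G m.
  rewrite /H /hamiltonian scaler_sumr; apply: eq_bigr => m _.
  by rewrite /G !scalerA; congr (_ *: _); rewrite rmorphN/= mulrC mulNr mulrN.
have LA t : L (A t).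
  exists (- 'i *: H t) => //; rewrite A_sum.
  apply: (big_ind (dla G)); [exact: dla_zero|exact: dla_add|move=> m _].
  by apply: dla_scale; exact: dla_gen.
have limA (F : set_system R) (FF : Filter F) l :
    mx_lim F H l -> mxcvg F A (- J *m realify l).
  move=> /mx_limP Hl.
  rewrite (_ : A = fun t => - J *m realify (H t)); last exact/funext.
  by apply: mxcvgM => //; exact: mxcvg_cst.
have limA' (F : set_system R) (FF : Filter F) t : mx_lim F H (H t) <-> mxcvg F A (A t).
  split; first by rewrite AJ; exact: limA.
  move=> AA; apply/mx_limP; rewrite HJ.
  rewrite (_ : (fun _ => _) = fun t => J *m A t); last exact/funext.
  by apply: mxcvgM => //; exact: mxcvg_cst.
have froA t : fro (A t) = Num.sqrt 2 * frob (H t).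
  by rewrite /A scaleNr realifyN froN fro_realify frob_iZ.
have [b0 A_bounded] : exists b0, forall t : R, 0 <= t -> fro (A t) <= b0.
  have [B HB] := choice h_bounded.
  exists (\sum_m B m * fro (realify (G m))) => t t0.
  rewrite /A A_sum realify_sum; apply: le_trans (fro_sum _ _ _) _.
  apply: ler_sum => m _; rewrite realifyZ froZ normrN ler_wpM2r//; exact: HB.
have [s [Hlim Hcont _]] := Hpw T T0.
have A_right (t : R) : 0 <= t < T -> exists l, mxcvg t^'+ A l.
  move=> /andP[t0 tT]; have [|_ [l /limA Al]] := Hlim t; first by rewrite t0 ltW.
  by eexists; exact: Al.
have A_left (t : R) : 0 < t <= T -> exists l, mxcvg t^'- A l.
  move=> /andP[t0 tT]; have [|[//|l /limA Al] _] := Hlim t; first by rewrite (ltW t0).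
  by eexists; exact: Al.
have A_cont (t : R) : 0 < t <= T -> t \notin s -> mxcvg (nbhs t) A (A t).
  by move=> tT ts; apply/limA'; exact: Hcont.
pose V t := realify (U t).
have V0 : V 0 = 1%:M by rewrite /V U0 realify1.
have V_right : mxcvg (0 : R)^'+ V (V 0) by apply/mx_limP.
have V_cont (t : R) : 0 < t -> mxcvg (nbhs t) V (V t).
  by move=> t0; apply/mx_limP; exact: U_cont.
have V_ode (t : R) : 0 < t -> mxcvg (nbhs t) A (A t) ->
    mxcvg (0 : R)^' (fun k : R => k^-1 *: (V (t + k) - V t)) (A t *m V t).
  move=> t0 /limA' /(U_ode t t0) /mx_limP.
  rewrite scalemxAl realifyM.
  by congr mxcvg; apply/funext => k; rewrite realifyZ realifyB.
have [Z [[X gX XZ] ZU ZI]] := real_propagator_log lieL T0 LA A_bounded A_right A_left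
  A_cont V0 V_right V_cont V_ode.
have mA := measurable_froA A_cont.
(* [X] is the logarithm of [U T] in the algebra: [- i (i X) = X] is exponentiated, and
   [i (i X) = - X] stays in the algebra. *)
exists ('i *: X); split.
- by rewrite /is_hermitian mxadj_iZ (dla_antiherm G_antiherm gX) scalerN opprK.
- rewrite scaleNr iiZ opprK /mxexp_is; apply/mx_limP.
  rewrite -/(V T) -ZU -XZ.
  rewrite (_ : (fun _ => _) = expser (realify X)); first exact: cvg_expser.
  by apply/funext => N; rewrite realify_expser.
- by rewrite iiZ -scaleN1r -(rmorphN1 (real_complex R)); exact: dla_scale.
(* Realification multiplies both sides of the norm bound by the same factor [Num.sqrt 2], which
   cancels. *)
- have s2 : 0 < Num.sqrt 2 :> R by rewrite sqrtr_gt0.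
  have frobZ : fro Z = Num.sqrt 2 * frob ('i *: X).
    by rewrite frob_iZ -fro_realify XZ.
  have mH : measurable_fun `[0, T] (fun t => frob (H t)).
    rewrite (_ : (fun _ => _) = (fun t => (Num.sqrt 2)^-1 * fro (A t))).
      by apply: measurable_funM => //; exact: measurable_cst.
    by apply/funext => t; rewrite froA mulKf// gt_eqF.
  move: ZI; rewrite frobZ.
  under eq_integral do rewrite froA EFinM.
  rewrite ge0_integralZl//; last 2 first.
  + exact/measurable_EFinP.
  + by move=> t _; rewrite lee_fin sqrtr_ge0.
  by rewrite EFinM lee_pmul2l.
Qed.
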